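(* Let $M>0$, $B_\infty\in\mathbb{R}$ and $p,q\in\mathbb{R}$. On the Schwarzschild exterior of mass $M$, consider the Lagrangian density $\mathscr{L}(\mathcal{F},\mathcal{G})=-\frac14\mathcal{F}+\lambda\,(p\mathcal{F}^2+q\mathcal{G}^2)+O(\lambda^2)$. (The Euler--Heisenberg theory corresponds to $(p,q)=(4,7)$ and the Born--Infeld theory to $(p,q)=(1,1)$.) Let $m_a$ be the 1-form $m=r^2\sin^2\theta\,\mathrm{d}\varphi$ dual to the axial Killing vector field $\partial/\partial\varphi$, let $$F_0=\tfrac12 B_\infty\,\mathrm{d}m = B_\infty\left(r\sin^2\theta\,\mathrm{d}r\wedge\mathrm{d}\varphi+r^2\cos\theta\sin\theta\,\mathrm{d}\theta\wedge\mathrm{d}\varphi\right),$$ and let $$v=\frac{p}{2}\,B_\infty^3 M\Big(4(2r-5M)\cos(2\theta)+(M-2r)\big(3+\cos(4\theta)\big)\Big)\,\mathrm{d}\varphi .$$ Then $F=F_0+\lambda\,\mathrm{d}v$ satisfies the nonlinear Maxwell equations to first order in $\lambda$: $\mathrm{d}F=0$ and $\mathrm{d}{*Z}=O(\lambda^2)$. Furthermore: (a) $F$ is asymptotically the homogeneous magnetic field $F_0$, in the sense that $$\lim_{r\to\infty}\frac{(\mathrm{d}v)_{r\varphi}}{(F_0)_{r\varphi}}=0,\qquad \lim_{r\to\infty}\frac{(\mathrm{d}v)_{\theta\varphi}}{(F_0)_{\theta\varphi}}=0$$ (for $B_\infty\neq0$ and fixed $\theta\in(0,\pi)$ at which the denominators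 do not vanish); (b) the electric charge $Q_\infty$ and the magnetic charge $P_\infty$ vanish up to and including order $\lambda^1$.
   Context: The Schwarzschild exterior is the region $r>2M$ with metric $\mathrm{d}s^2=-f(r)\,\mathrm{d}t^2+\frac{\mathrm{d}r^2}{f(r)}+r^2(\mathrm{d}\theta^2+\sin^2\theta\,\mathrm{d}\varphi^2)$, $f(r)=1-\frac{2M}{r}$, oriented by $(t,r,\theta,\varphi)$; the differential equations are understood for $\theta\in(0,\pi)$, away from the axis. For a 2-form $F_{ab}$, $\mathcal{F}=F_{ab}F^{ab}$ and $\mathcal{G}=F_{ab}\,{*F}^{ab}$, with Hodge dual $( *\omega)_{cd}=\frac12\omega_{ab}\epsilon^{ab}{}_{cd}$. The auxiliary 2-form is $Z=-4(\mathscr{L}_{\mathcal{F}}\,F+\mathscr{L}_{\mathcal{G}}\,{*F})$, where subscripts $\mathcal{F},\mathcal{G}$ denote partial derivatives. The nonlinear Maxwell equations are $\mathrm{d}F=0$, $\mathrm{d}{*Z}=0$. The metric is a fixed background. The $O(\lambda^2)$ terms in $\mathscr{L}$ depend smoothly on all variables. Charges: $Q_{\mathcal{S}}=\frac{1}{4\pi}\oint_{\mathcal{S}}{*Z}$ and $P_{\mathcal{S}}=\frac1{4\pi}\oint_{\mathcal{S}}F$ for a closed 2-surface $\mathcal{S}$; $Q_\infty,P_\infty$ are the limits as $r\to\infty$ of these charges for the spheres of constant $t$ and $r$ (taken at each order in $\lambda$). *)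

(* Defs.v *)
From Stdlib Require Import Reals.
From Coquelicot Require Import Coquelicot.
Open Scope R_scope.

Inductive coord : Set := ct | cr | cth | cph.

Definition coord_eq_dec (a b : coord) : {a = b} + {a <> b}.
Proof. decide equality. Defined.

(* A function type into a uniform space carries the sup-metric uniform
   structure in Coquelicot; as [coord] has four elements, this is the usual
   topology of R^4. *)
Definition point := coord -> R.

Definition pt (t r th ph : R) : point :=
  fun a => match a with ct => t | cr => r | cth => th | cph => ph end.

Definition upd (x : point) (a : coord) (s : R) : point :=
  fun b => if coord_eq_dec a b then s else x b.

Definition partial (a : coord) (f : point -> R) (x : point) : R :=
  Derive (fun s => f (upd x a s)) (x a).

Definition ex_partial (a : coord) (f : point -> R) (x : point) : Prop :=
  ex_derive (fun s => f (upd x a s)) (x a).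

Definition sum4 (f : coord -> R) : R := f ct + f cr + f cth + f cph.

Definition kdelta (a b : coord) : R := if coord_eq_dec a b then 1 else 0.

(* Differential forms are given by their (antisymmetric) components:
   [w x a b] is w_{ab} at the point x. *)
Definition form1 := point -> coord -> R.
Definition form2 := point -> coord -> coord -> R.
Definition form3 := point -> coord -> coord -> coord -> R.

Definition dext1 (w : form1) : form2 := fun x a b =>
  partial a (fun y => w y b) x - partial b (fun y => w y a) x.

Definition dext2 (w : form2) : form3 := fun x a b c =>
  partial a (fun y => w y b c) x
  + partial b (fun y => w y c a) x
  + partial c (fun y => w y a b) x.

(* All first partial derivatives of all components exist at x, so that the
   total operator [Derive] inside [dext2 w x] has its intended meaning. *)
Definition ex_dext2 (w : form2) (x : point) : Prop :=
  forall a b c : coord, ex_partial a (fun y => w y b c) x.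

Definition add2 (w1 w2 : form2) : form2 := fun x a b => w1 x a b + w2 x a b.
Definition scal2 (k : R) (w : form2) : form2 := fun x a b => k * w x a b.

Definition dxdx (c d a b : coord) : R :=
  kdelta c a * kdelta d b - kdelta c b * kdelta d a.

Definition exterior (M : R) (x : point) : Prop :=
  2 * M < x cr /\ 0 < x cth < PI.

Definition fS (M r : R) : R := 1 - 2 * M / r.

Definition metric_diag (M : R) (x : point) (a : coord) : R :=
  match a with
  | ct => - fS M (x cr)
  | cr => / fS M (x cr)
  | cth => x cr ^ 2
  | cph => x cr ^ 2 * sin (x cth) ^ 2
  end.

Definition metric (M : R) (x : point) (a b : coord) : R :=
  kdelta a b * metric_diag M x a.

(* g^{ab}; the metric is diagonal, so it is inverted entrywise *)
Definition inv_metric (M : R) (x : point) (a b : coord) : R :=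
  kdelta a b * / metric_diag M x a.

Definition det_metric (M : R) (x : point) : R :=
  metric_diag M x ct * metric_diag M x cr
  * metric_diag M x cth * metric_diag M x cph.

Definition coord_rank (a : coord) : R :=
  match a with ct => 0 | cr => 1 | cth => 2 | cph => 3 end.

(* Levi-Civita symbol, +1 on (t, r, theta, phi): the sign of the product of
   all coord_rank b - coord_rank a with a standing before b, hence 0 on repetitions. *)
Definition levi_civita (a b c d : coord) : R :=
  sign ((coord_rank b - coord_rank a) * (coord_rank c - coord_rank a) * (coord_rank d - coord_rank a)
        * (coord_rank c - coord_rank b) * (coord_rank d - coord_rank b) * (coord_rank d - coord_rank c)).

Definition vol (M : R) (x : point) (a b c d : coord) : R :=
  sqrt (Rabs (det_metric M x)) * levi_civita a b c d.

Definition raise2 (M : R) (w : form2) (x : point) (a b : coord) : R :=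
  sum4 (fun a' => sum4 (fun b' =>
    inv_metric M x a a' * inv_metric M x b b' * w x a' b')).

Definition vol_up2 (M : R) (x : point) (a b c d : coord) : R :=
  sum4 (fun a' => sum4 (fun b' =>
    inv_metric M x a a' * inv_metric M x b b' * vol M x a' b' c d)).

Definition hodge (M : R) (w : form2) : form2 := fun x c d =>
  / 2 * sum4 (fun a => sum4 (fun b => w x a b * vol_up2 M x a b c d)).

Definition contract2 (M : R) (w w' : form2) (x : point) : R :=
  sum4 (fun a => sum4 (fun b => w x a b * raise2 M w' x a b)).

Definition invF (M : R) (F : form2) (x : point) : R := contract2 M F F x.
Definition invG (M : R) (F : form2) (x : point) : R :=
  contract2 M F (hodge M F) x.

Definition part1 (f : R -> R -> R -> R) : R -> R -> R -> R :=
  fun l a b => Derive (fun s => f s a b) l.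
Definition part2 (f : R -> R -> R -> R) : R -> R -> R -> R :=
  fun l a b => Derive (fun s => f l s b) a.
Definition part3 (f : R -> R -> R -> R) : R -> R -> R -> R :=
  fun l a b => Derive (fun s => f l a s) b.

Fixpoint Cn_on (n : nat) (U : R * (R * R) -> Prop) (f : R -> R -> R -> R)
  : Prop :=
  match n with
  | O => forall z, U z ->
      continuous (fun y : R * (R * R) => f (fst y) (fst (snd y)) (snd (snd y))) z
  | S k =>
      (forall l a b, U (l, (a, b)) ->
         ex_derive (fun s => f s a b) l
         /\ ex_derive (fun s => f l s b) a
         /\ ex_derive (fun s => f l a s) b)
      /\ Cn_on k U (part1 f) /\ Cn_on k U (part2 f) /\ Cn_on k U (part3 f)
  end.

Definition smooth_on (U : R * (R * R) -> Prop) (f : R -> R -> R -> R) : Prop :=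
  forall n, Cn_on n U f.

(* h lambda x = O(lambda^2) as lambda -> 0, locally uniformly in x in D *)
Definition O_lambda2 {T : UniformSpace} (D : T -> Prop) (h : R -> T -> R)
  : Prop :=
  forall x0 : T, D x0 ->
  exists C : R, locally ((0, x0) : R * T)
    (fun z => Rabs (h (fst z) (snd z)) <= C * fst z ^ 2).

(* L lambda F G = - F/4 + lambda (p F^2 + q G^2) + O(lambda^2), with the
   remainder smooth in (lambda, F, G).  For theories of Born-Infeld type the
   Lagrangian only makes sense for small lambda, depending on F and G; so
   smoothness is required on an open set U around {lambda = 0}. *)
Definition remainder (p q : R) (L : R -> R -> R -> R) : R -> R -> R -> R :=
  fun lam F G => L lam F G - (- / 4 * F + lam * (p * F ^ 2 + q * G ^ 2)).

Definition lagrangian_expansion (p q : R) (L : R -> R -> R -> R) : Prop :=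
  (exists U : R * (R * R) -> Prop,
      open U /\ (forall F G, U (0, (F, G))) /\ smooth_on U (remainder p q L))
  /\ O_lambda2 (fun _ : R * R => True)
       (fun lam z => remainder p q L lam (fst z) (snd z)).

Definition Zform (M : R) (L : R -> R -> R -> R) (lam : R) (F : form2) : form2 :=
  fun x a b =>
    -4 * (part2 L lam (invF M F x) (invG M F x) * F x a b
          + part3 L lam (invF M F x) (invG M F x) * hodge M F x a b).

(* The sphere of constant t and r is oriented by (theta, phi).  Riemann integrability does not depend on the
   values at the poles theta = 0, pi, where the components are not
   meaningful. *)
Definition is_charge (w : form2) (t r c : R) : Prop :=
  exists inner : R -> R,
    (forall ph, 0 <= ph <= 2 * PI ->
       is_RInt (fun th => w (pt t r th ph) cth cph) 0 PI (inner ph))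
    /\ is_RInt inner 0 (2 * PI) (4 * PI * c).

(* For small lambda the charge of w lambda exists and is
   c0 + c1 lambda + O(lambda^2). *)
Definition charge_expansion (w : R -> form2) (t r c0 c1 : R) : Prop :=
  exists C : R, locally 0 (fun lam : R => exists c : R,
    is_charge (w lam) t r c /\ Rabs (c - (c0 + c1 * lam)) <= C * lam ^ 2).

(* The coefficients of order lambda^0 and lambda^1 of the charge tend to c0
   and c1 as r -> infinity. *)
Definition charge_at_infinity (M : R) (w : R -> form2) (t c0 c1 : R) : Prop :=
  exists q0 q1 : R -> R,
    (forall r, 2 * M < r -> charge_expansion w t r (q0 r) (q1 r))
    /\ is_lim q0 p_infty c0 /\ is_lim q1 p_infty c1.

Definition d_phi : coord -> R := kdelta cph.

Definition m_form (M : R) : form1 := fun x a =>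
  sum4 (fun b => metric M x a b * d_phi b).

Definition F0 (M B : R) : form2 := scal2 (/ 2 * B) (dext1 (m_form M)).

Definition v_form (M B p : R) : form1 := fun x a =>
  p / 2 * B ^ 3 * M
  * (4 * (2 * x cr - 5 * M) * cos (2 * x cth)
     + (M - 2 * x cr) * (3 + cos (4 * x cth)))
  * kdelta cph a.

Definition Fsol (M B p lam : R) : form2 :=
  add2 (F0 M B) (scal2 lam (dext1 (v_form M B p))).

(* Main.v *)
Require Import Defs.
From Stdlib Require Import Reals Lra ClassicalEpsilon.
From Coquelicot Require Import Coquelicot.
Open Scope R_scope.
Set Bullet Behavior "Strict Subproofs".

(** The remainder R of the Lagrangian vanishes to second order at lambda = 0,
    and by Schwarz's theorem so do all its partial derivatives in F and G; Taylor
    in lambda then makes them O(lambda^2) locally uniformly.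

    F has only the components F_{r phi} and F_{theta phi}, hence G = 0
    identically and d*Z has only a (t, r, theta) and an (r, theta, phi)
    component.  The former is a divergence in (r, theta) whose orders 0 and 1 in
    lambda cancel identically; what is left of both components is lambda^2, or
    an R-derivative, times a continuous function.  sin^2 theta is written as
    1 - cos^2 theta throughout, so that this cancellation is a field identity.

    The (theta, phi) component of *Z is 4 L_G F_{theta phi} with
    L_G = O(lambda^2), and F regularizes at the poles, so the electric charge of
    each sphere is O(lambda^2) by compactness of [0, pi].  F_{theta phi} is the
    theta-derivative of a potential with equal values at the poles, so the
    magnetic charge vanishes. *)

(** * Functions flat at lambda = 0 *)

(** Coquelicot states such equalities over the carrier of an algebraic structure; [ring] and [field]
    recognize them once the type is literally [R]. *)
Ltac eq_in_R := match goal with |- @eq _ ?x ?y => change (@eq R x y) end.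

Lemma locally_triple_box (P : R * (R * R) -> Prop) (l F G : R) :
  locally ((l, (F, G)) : R * (R * R)) P <->
  exists d : posreal, forall l' F' G', Rabs (l' - l) < d -> Rabs (F' - F) < d ->
    Rabs (G' - G) < d -> P (l', (F', G')).
Proof.
  split.
  - intros [d H]. exists d. intros l' F' G' H1 H2 H3. apply H.
    split; [exact H1|]. split; [exact H2|exact H3].
  - intros [d H]. exists d. intros [l' [F' G']] [H1 [H2 H3]].
    apply H; [exact H1|exact H2|exact H3].
Qed.

Lemma Rabs_diag (x : R) (d : posreal) : Rabs (x - x) < d.
Proof. rewrite Rminus_diag, Rabs_R0. apply cond_pos. Qed.

Lemma smooth_on_part (U : R * (R * R) -> Prop) f :
  smooth_on U f ->
  smooth_on U (part1 f) /\ smooth_on U (part2 f) /\ smooth_on U (part3 f).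
Proof. intros H; repeat split; intro n; apply (H (S n)). Qed.

Lemma smooth_on_ex_derive (U : R * (R * R) -> Prop) f l a b :
  smooth_on U f -> U (l, (a, b)) ->
  ex_derive (fun s => f s a b) l /\ ex_derive (fun s => f l s b) a
  /\ ex_derive (fun s => f l a s) b.
Proof. intros H HU. apply (H 1%nat); exact HU. Qed.

Lemma smooth_on_continuous (U : R * (R * R) -> Prop) f z :
  smooth_on U f -> U z ->
  continuous (fun y : R * (R * R) => f (fst y) (fst (snd y)) (snd (snd y))) z.
Proof. intros H HU. exact (H 0%nat z HU). Qed.

(** With G frozen at [b], this is the two-variable [Schwarz] in the (lambda, F) plane. Openness of
    [U] gives the derivatives on a neighbourhood, and [Cn_on] gives continuity of both mixed
    partials. *)
Lemma smooth_on_schwarz12 (U : R * (R * R) -> Prop) f l a b :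
  open U -> smooth_on U f -> U (l, (a, b)) ->
  part1 (part2 f) l a b = part2 (part1 f) l a b.
Proof.
  intros HO Hf HU.
  destruct (smooth_on_part U f Hf) as (Hf1 & Hf2 & _).
  destruct (smooth_on_part U _ Hf1) as (_ & Hf12 & _).
  destruct (smooth_on_part U _ Hf2) as (Hf21 & _ & _).
  assert (Hc : forall g, smooth_on U g ->
    continuity_2d_pt (fun u v => g u v b) l a).
  { intros g Hg. apply continuity_2d_pt_filterlim.
    assert (Hg' := smooth_on_continuous U g _ Hg HU).
    apply (continuous_comp
      (fun z : R * R => ((fst z, (snd z, b)) : R * (R * R)))
      (fun y : R * (R * R) => g (fst y) (fst (snd y)) (snd (snd y))) (l, a));
      [|exact Hg'].
    intros P [d HP]. exists d. intros [u v] [Hu Hv]. apply HP.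
    split; [exact Hu|]. split; [exact Hv|]. apply ball_center. }
  unfold part1, part2. symmetry.
  refine (eq_sym (Schwarz (fun u v => f u v b) l a _ _ _)).
  - destruct (proj1 (locally_triple_box _ _ _ _) (HO _ HU)) as [d Hd].
    exists d. intros u v Hu Hv.
    assert (HU' : U (u, (v, b))) by (apply Hd; auto using Rabs_diag).
    destruct (smooth_on_ex_derive U f u v b Hf HU') as (E1 & E2 & _).
    destruct (smooth_on_ex_derive U _ u v b Hf1 HU') as (_ & E3 & _).
    destruct (smooth_on_ex_derive U _ u v b Hf2 HU') as (E4 & _).
    repeat split; assumption.
  - exact (Hc _ Hf21).
  - exact (Hc _ Hf12).
Qed.

Lemma smooth_on_schwarz13 (U : R * (R * R) -> Prop) f l a b :
  open U -> smooth_on U f -> U (l, (a, b)) ->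
  part1 (part3 f) l a b = part3 (part1 f) l a b.
Proof.
  intros HO Hf HU.
  destruct (smooth_on_part U f Hf) as (Hf1 & _ & Hf2).
  destruct (smooth_on_part U _ Hf1) as (_ & _ & Hf12).
  destruct (smooth_on_part U _ Hf2) as (Hf21 & _ & _).
  assert (Hc : forall g, smooth_on U g ->
    continuity_2d_pt (fun u v => g u a v) l b).
  { intros g Hg. apply continuity_2d_pt_filterlim.
    assert (Hg' := smooth_on_continuous U g _ Hg HU).
    apply (continuous_comp
      (fun z : R * R => ((fst z, (a, snd z)) : R * (R * R)))
      (fun y : R * (R * R) => g (fst y) (fst (snd y)) (snd (snd y))) (l, b));
      [|exact Hg'].
    intros P [d HP]. exists d. intros [u v] [Hu Hv]. apply HP.
    split; [exact Hu|]. split; [apply ball_center|exact Hv]. }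
  unfold part1, part3. symmetry.
  refine (eq_sym (Schwarz (fun u v => f u a v) l b _ _ _)).
  - destruct (proj1 (locally_triple_box _ _ _ _) (HO _ HU)) as [d Hd].
    exists d. intros u v Hu Hv.
    assert (HU' : U (u, (a, v))) by (apply Hd; auto using Rabs_diag).
    destruct (smooth_on_ex_derive U f u a v Hf HU') as (E1 & _ & E2).
    destruct (smooth_on_ex_derive U _ u a v Hf1 HU') as (_ & _ & E3).
    destruct (smooth_on_ex_derive U _ u a v Hf2 HU') as (E4 & _).
    repeat split; assumption.
  - exact (Hc _ Hf21).
  - exact (Hc _ Hf12).
Qed.

(** A double zero in lambda along the whole slice lambda = 0. Asking it for all F and G at once is
    what lets the class pass to derivatives in F and G. *)
Definition flat_on (U : R * (R * R) -> Prop) (g : R -> R -> R -> R) : Prop :=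
  smooth_on U g /\ forall F G, g 0 F G = 0 /\ part1 g 0 F G = 0.

Lemma Derive_zero (f : R -> R) (x : R) : (forall s, f s = 0) -> Derive f x = 0.
Proof.
  intros H. rewrite (Derive_ext f (fun _ => 0) x H). apply Derive_const.
Qed.

Lemma flat_on_part (U : R * (R * R) -> Prop) g :
  open U -> (forall F G, U (0, (F, G))) -> flat_on U g ->
  flat_on U (part2 g) /\ flat_on U (part3 g).
Proof.
  intros HO H0 [Hs Hg]. destruct (smooth_on_part U g Hs) as (_ & S2 & S3).
  split; (split; [assumption|]); intros F G; split.
  - apply Derive_zero. intro s. apply Hg.
  - rewrite (smooth_on_schwarz12 U); auto. apply Derive_zero. intro s. apply Hg.
  - apply Derive_zero. intro s. apply Hg.
  - rewrite (smooth_on_schwarz13 U); auto. apply Derive_zero. intro s. apply Hg.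
Qed.

Lemma continuous_locally_bounded {T : UniformSpace} (h : T -> R) (x : T) :
  continuous h x -> locally x (fun y => Rabs (h y) <= Rabs (h x) + 1).
Proof.
  intros H. specialize (H (fun u => Rabs u <= Rabs (h x) + 1)). apply H.
  exists (mkposreal 1 Rlt_0_1). intros u Hu.
  change (Rabs (u - h x) < 1) in Hu.
  replace u with ((u - h x) + h x) by ring.
  eapply Rle_trans; [apply Rabs_triang|]. lra.
Qed.

(** Applied first to the lambda-derivative and then to the function, it turns a bound on the second
    derivative into a quadratic bound. *)
Lemma mean_value_at_zero (f df : R -> R) (l C : R) :
  f 0 = 0 ->
  (forall s, Rabs s <= Rabs l -> is_derive f s (df s) /\ Rabs (df s) <= C) ->
  Rabs (f l) <= C * Rabs l.
Proof.
  intros f0 H.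
  assert (Hs : forall s, Rmin 0 l <= s <= Rmax 0 l -> Rabs s <= Rabs l).
  { intros s. unfold Rmin, Rmax, Rabs.
    destruct (Rle_dec 0 l), (Rcase_abs s), (Rcase_abs l); lra. }
  destruct (MVT_gen f 0 l df) as [c [Hc E]].
  - intros x Hx. apply H, Hs; lra.
  - intros x Hx. apply derivable_continuous_pt. exists (df x).
    apply is_derive_Reals, H, Hs; lra.
  - rewrite f0 in E. replace (f l) with (df c * l) by lra.
    rewrite Rabs_mult. apply Rmult_le_compat_r; [apply Rabs_pos|].
    apply H, Hs, Hc.
Qed.

Lemma flat_on_O_lambda2 (U : R * (R * R) -> Prop) g F0 G0 :
  open U -> (forall F G, U (0, (F, G))) -> flat_on U g ->
  exists C, locally ((0, (F0, G0)) : R * (R * R))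
    (fun z => Rabs (g (fst z) (fst (snd z)) (snd (snd z))) <= C * fst z ^ 2).
Proof.
  intros HO H0 [Hs Hg]. destruct (smooth_on_part U g Hs) as (S1 & _ & _).
  destruct (smooth_on_part U _ S1) as (S11 & _ & _).
  assert (Hb := continuous_locally_bounded _ _
    (smooth_on_continuous U _ _ S11 (H0 F0 G0))).
  (* [C] bounds the second lambda-derivative near the base point. *)
  set (C := _ + 1) in Hb.
  exists C.
  apply locally_triple_box.
  destruct (proj1 (locally_triple_box _ _ _ _)
    (filter_and _ _ (HO _ (H0 F0 G0)) Hb)) as [d Hd].
  exists d. intros l F G Hl HF HG. simpl fst; simpl snd.
  (* The box is symmetric about lambda = 0, so it contains the whole segment from 0 to [l] over the
     same F and G. *)
  assert (Hd' : forall s, Rabs s <= Rabs l -> U (s, (F, G))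
    /\ Rabs (part1 (part1 g) s F G) <= C).
  { intros s Hs'. apply (Hd s F G); auto. rewrite Rminus_0_r in *. lra. }
  assert (HC : 0 <= C).
  { eapply Rle_trans; [apply Rabs_pos|]. apply (Hd' 0).
    rewrite Rabs_R0. apply Rabs_pos. }
  replace (C * l ^ 2) with ((C * Rabs l) * Rabs l)
    by (rewrite Rmult_assoc, <- Rabs_mult, (Rabs_pos_eq (l * l)); [ring|nra]).
  apply (mean_value_at_zero (fun s => g s F G) (fun s => part1 g s F G));
    [apply Hg|].
  intros s Hsl. destruct (Hd' s Hsl) as [HU _]. split.
  { apply Derive_correct. apply (smooth_on_ex_derive U g s F G Hs HU). }
  eapply Rle_trans.
  { apply (mean_value_at_zero (fun s => part1 g s F G)
      (fun s => part1 (part1 g) s F G) s C); [apply Hg|].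
    intros u Hu. destruct (Hd' u) as [HU' Hu2]; [lra|]. split; [|exact Hu2].
    apply Derive_correct. apply (smooth_on_ex_derive U _ u F G S1 HU'). }
  apply Rmult_le_compat_l; assumption.
Qed.

Lemma is_derive_zero_of_quadratic_bound (f : R -> R) (C : R) :
  locally 0 (fun s => Rabs (f s) <= C * s ^ 2) -> is_derive f 0 0.
Proof.
  intros [d Hd]. apply is_derive_Reals. intros eps Heps.
  assert (f0 : f 0 = 0).
  { assert (H := Hd 0 (ball_center 0 d)).
    assert (H' := Rabs_pos (f 0)).
    replace (C * 0 ^ 2) with 0 in H by ring.
    destruct (Req_dec (f 0) 0) as [E|E]; [exact E|].
    apply Rabs_pos_lt in E. lra. }
  assert (HC : 0 < Rabs C + 1) by (assert (H := Rabs_pos C); lra).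
  (* The radius makes (|C| + 1) |h| < eps, which dominates the difference quotient; the summand 1
     keeps the divisor positive when C = 0. *)
  assert (He : 0 < Rmin d (eps / (Rabs C + 1))).
  { apply Rmin_glb_lt; [apply cond_pos|]. apply Rdiv_lt_0_compat; lra. }
  exists (mkposreal _ He). simpl. intros h Hh Hlt.
  assert (Hh' : 0 < Rabs h) by (apply Rabs_pos_lt; exact Hh).
  rewrite f0, Rplus_0_l, !Rminus_0_r. unfold Rdiv.
  rewrite Rabs_mult, Rabs_inv.
  apply (Rmult_lt_reg_r (Rabs h)); [exact Hh'|].
  rewrite Rmult_assoc, Rinv_l, Rmult_1_r by lra.
  assert (Hfh : Rabs (f h) <= C * h ^ 2).
  { apply Hd. change (Rabs (h - 0) < d). rewrite Rminus_0_r.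
    eapply Rlt_le_trans; [exact Hlt|apply Rmin_l]. }
  assert (Hlt2 : Rabs h < eps / (Rabs C + 1))
    by (eapply Rlt_le_trans; [exact Hlt|apply Rmin_r]).
  assert (Hlt3 : Rabs h * (Rabs C + 1) < eps).
  { apply (Rmult_lt_compat_r (Rabs C + 1)) in Hlt2; [|exact HC].
    unfold Rdiv in Hlt2. rewrite Rmult_assoc, Rinv_l in Hlt2 by lra. lra. }
  rewrite <- (pow2_abs h) in Hfh. assert (H := Rle_abs C). nra.
Qed.

(** At fixed F and G the bound reads |R| <= C lambda^2: at lambda = 0 it forces R = 0, and near 0 it
    forces a zero derivative. *)
Lemma remainder_flat_on (p q : R) L (U : R * (R * R) -> Prop) :
  smooth_on U (remainder p q L) ->
  O_lambda2 (fun _ : R * R => True)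
       (fun lam z => remainder p q L lam (fst z) (snd z)) ->
  flat_on U (remainder p q L).
Proof.
  intros Hs HO. split; [exact Hs|]. intros F G.
  destruct (HO (F, G) I) as [C HC].
  destruct (proj1 (locally_triple_box _ _ _ _) HC) as [d Hd].
  assert (Hq : forall l, Rabs (l - 0) < d ->
    Rabs (remainder p q L l F G) <= C * l ^ 2).
  { intros l Hl. apply (Hd l F G); auto using Rabs_diag. }
  split.
  - assert (H := Hq 0 (Rabs_diag 0 d)).
    replace (C * 0 ^ 2) with 0 in H by ring.
    destruct (Req_dec (remainder p q L 0 F G) 0) as [E|E]; [exact E|].
    apply Rabs_pos_lt in E. lra.
  - apply is_derive_unique, (is_derive_zero_of_quadratic_bound _ C).
    exists d. intros l Hl. apply Hq, Hl.
Qed.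

(** * Derivatives of the Lagrangian through its remainder *)

Lemma part2_of_remainder p q L l F G :
  ex_derive (fun s => remainder p q L l s G) F ->
  part2 L l F G = - / 4 + 2 * l * p * F + part2 (remainder p q L) l F G.
Proof.
  intros H. apply Derive_correct in H. apply is_derive_unique.
  apply (is_derive_ext (fun s => (- / 4 * s + l * (p * s ^ 2 + q * G ^ 2))
    + remainder p q L l s G)).
  { intro s. unfold remainder. eq_in_R; ring. }
  apply (is_derive_plus (V := R_NormedModule)); [|exact H].
  auto_derive; [exact I|eq_in_R; ring].
Qed.

Lemma part3_of_remainder p q L l F G :
  ex_derive (fun s => remainder p q L l F s) G ->
  part3 L l F G = 2 * l * q * G + part3 (remainder p q L) l F G.
Proof.
  intros H. apply Derive_correct in H. apply is_derive_unique.
  apply (is_derive_ext (fun s => (- / 4 * F + l * (p * F ^ 2 + q * s ^ 2))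
    + remainder p q L l F s)).
  { intro s. unfold remainder. eq_in_R; ring. }
  apply (is_derive_plus (V := R_NormedModule)); [|exact H].
  auto_derive; [exact I|eq_in_R; ring].
Qed.

Lemma locally_second_slot (U : R * (R * R) -> Prop) l F G :
  open U -> U (l, (F, G)) -> locally F (fun s => U (l, (s, G))).
Proof.
  intros HO HU.
  destruct (proj1 (locally_triple_box _ _ _ _) (HO _ HU)) as [d Hd].
  exists d. intros s Hs. apply Hd; auto using Rabs_diag.
Qed.

(** The formula for L_F holds at all nearby values of F because [U] is open, so it may be
    differentiated once more. *)
Lemma is_derive_part2_slot2 p q L (U : R * (R * R) -> Prop) l F G :
  open U -> smooth_on U (remainder p q L) -> U (l, (F, G)) ->
  is_derive (fun s => part2 L l s G) F
    (2 * l * p + part2 (part2 (remainder p q L)) l F G).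
Proof.
  intros HO Hs HU. destruct (smooth_on_part U _ Hs) as (_ & S2 & _).
  apply (is_derive_ext_loc
    (fun s => (- / 4 + 2 * l * p * s) + part2 (remainder p q L) l s G)).
  { generalize (locally_second_slot U l F G HO HU). apply filter_imp.
    intros s HUs. symmetry. apply part2_of_remainder.
    apply (smooth_on_ex_derive U _ l s G Hs HUs). }
  apply (is_derive_plus (V := R_NormedModule)).
  - auto_derive; [exact I|eq_in_R; ring].
  - apply Derive_correct, (smooth_on_ex_derive U _ l F G S2 HU).
Qed.

(** On the slice G = 0 the term 2 lambda q G of L_G is zero, so L_G coincides there with the
    G-derivative of the remainder. *)
Lemma is_derive_part3_slot2 p q L (U : R * (R * R) -> Prop) l F :
  open U -> smooth_on U (remainder p q L) -> U (l, (F, 0)) ->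
  is_derive (fun s => part3 L l s 0) F
    (part2 (part3 (remainder p q L)) l F 0).
Proof.
  intros HO Hs HU. destruct (smooth_on_part U _ Hs) as (_ & _ & S3).
  apply (is_derive_ext_loc (fun s => part3 (remainder p q L) l s 0)).
  { generalize (locally_second_slot U l F 0 HO HU). apply filter_imp.
    intros s HUs. rewrite (part3_of_remainder p q L); [eq_in_R; ring|].
    apply (smooth_on_ex_derive U _ l s 0 Hs HUs). }
  apply Derive_correct, (smooth_on_ex_derive U _ l F 0 S3 HU).
Qed.

(** Compactness of [a, b] merges the local bounds into one. [P] travels along so that a single
    lambda-neighbourhood also secures a side condition, later membership in [U]. *)
Lemma O_square_uniform_on_segment (a b : R) (P : R -> R -> Prop) (h : R -> R -> R) :
  (forall x, a <= x <= b -> exists C, locally ((0, x) : R * R)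
     (fun z => P (fst z) (snd z) /\ Rabs (h (fst z) (snd z)) <= C * fst z ^ 2)) ->
  exists C, locally 0 (fun l => forall x, a <= x <= b ->
     P l x /\ Rabs (h l x) <= C * l ^ 2).
Proof.
  intros H.
  (* A single radius d carries the constant as well, C being replaced by / d. *)
  assert (H1 : forall x, exists d : posreal, a <= x <= b -> forall l y,
    Rabs l < d -> Rabs (y - x) < d -> P l y /\ Rabs (h l y) <= / d * l ^ 2).
  { intro x. destruct (classic (a <= x <= b)) as [Hx|Hx].
    2: { exists (mkposreal 1 Rlt_0_1). tauto. }
    destruct (H x Hx) as [C [d Hd]].
    assert (HC : 0 < Rabs C + 1) by (assert (H' := Rabs_pos C); lra).
    assert (He : 0 < Rmin d (/ (Rabs C + 1)))
      by (apply Rmin_glb_lt; [apply cond_pos|apply Rinv_0_lt_compat, HC]).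
    exists (mkposreal _ He). simpl. intros _ l y Hl Hy.
    destruct (Hd (l, y)) as [HP Hh].
    { split; [change (Rabs (l - 0) < d); rewrite Rminus_0_r
             |change (Rabs (y - x) < d)];
      (eapply Rlt_le_trans; [eassumption|apply Rmin_l]). }
    split; [exact HP|]. simpl in Hh.
    eapply Rle_trans; [exact Hh|]. apply Rmult_le_compat_r; [nra|].
    assert (Hi : / / (Rabs C + 1) <= / Rmin d (/ (Rabs C + 1)))
      by (apply Rinv_le_contravar; [exact He|apply Rmin_r]).
    rewrite Rinv_inv in Hi. assert (H' := Rle_abs C). simpl. lra. }
  (* [compactness_value_1d] takes the radii as a function, hence the choice operator. *)
  set (delta := fun x => proj1_sig
    (constructive_indefinite_description _ (H1 x))).
  assert (Hdelta : forall x, a <= x <= b -> forall l y,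
    Rabs l < delta x -> Rabs (y - x) < delta x ->
    P l y /\ Rabs (h l y) <= / delta x * l ^ 2).
  { intro x. exact (proj2_sig (constructive_indefinite_description _ (H1 x))). }
  destruct (compactness_value_1d a b delta) as [d Hd].
  exists (/ d), d. intros l Hl x Hx.
  change (Rabs (l - 0) < d) in Hl. rewrite Rminus_0_r in Hl.
  (* The covering point [u] is provided only under a double negation. It satisfies d <= [delta u],
     so / d is a common constant. *)
  apply NNPP. intro Hn. apply (Hd x Hx). intros [u (Hu & Hux & Hdu)]. apply Hn.
  destruct (Hdelta u Hu l x) as [HP Hh]; [lra|exact Hux|].
  split; [exact HP|]. eapply Rle_trans; [exact Hh|].
  apply Rmult_le_compat_r; [nra|]. apply Rinv_le_contravar; [apply cond_pos|lra].
Qed.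

(** * The Hodge dual *)

(** The components allowed in a stationary axisymmetric field without (t, phi) and (r, theta) parts.
    The Hodge dual preserves this shape, so it serves F, Z and *Z alike. *)
Definition stax_form (tr tth rph thph : R) (a b : coord) : R :=
  tr * dxdx ct cr a b + tth * dxdx ct cth a b
  + rph * dxdx cr cph a b + thph * dxdx cth cph a b.

Ltac expand_comps := unfold stax_form, dxdx, kdelta; simpl.

Lemma vol_up2_diag M x a b c d :
  vol_up2 M x a b c d =
  / metric_diag M x a * / metric_diag M x b * vol M x a b c d.
Proof.
  unfold vol_up2, inv_metric, sum4. destruct a, b; expand_comps; ring.
Qed.

Lemma raise2_diag M w x a b :
  raise2 M w x a b = / metric_diag M x a * / metric_diag M x b * w x a b.
Proof.
  unfold raise2, inv_metric, sum4. destruct a, b; expand_comps; ring.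
Qed.

Ltac levi := unfold levi_civita, coord_rank;
  match goal with |- sign ?e = _ =>
   first [ rewrite (sign_eq_1 e) by lra; reflexivity
         | rewrite (sign_eq_m1 e) by lra; reflexivity
         | replace e with 0 by ring; apply sign_0 ] end.

Lemma levi_civita_antisym_left a b c d :
  levi_civita b a c d = - levi_civita a b c d.
Proof.
  unfold levi_civita. rewrite <- sign_opp. f_equal. ring.
Qed.

(** The leading pairs are those on which a [stax_form] can be nonzero; their transposes follow by
    antisymmetry. *)
Lemma levi_civita_table c d :
  levi_civita cr cph c d = - dxdx ct cth c d
  /\ levi_civita cth cph c d = dxdx ct cr c d
  /\ levi_civita ct cth c d = - dxdx cr cph c d
  /\ levi_civita ct cr c d = dxdx cth cph c d.
Proof.
  repeat split; destruct c, d; expand_comps; ring_simplify; levi.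
Qed.

Lemma exterior_fS_pos (M : R) (x : point) :
  0 < M -> exterior M x -> 0 < fS M (x cr).
Proof.
  intros HM Hx. destruct Hx as [Hr _]. unfold fS.
  assert (2 * M / x cr < 1).
  { apply (Rmult_lt_reg_r (x cr)); [lra|]. unfold Rdiv.
    rewrite Rmult_assoc, Rinv_l by lra. lra. }
  lra.
Qed.

Lemma sqrt_det_metric (M : R) (x : point) :
  0 < M -> exterior M x ->
  sqrt (Rabs (det_metric M x)) = x cr ^ 2 * sin (x cth).
Proof.
  intros HM Hx.
  assert (Hf := exterior_fS_pos M x HM Hx). pose proof Hx as [Hr Hth].
  assert (Hs : 0 < sin (x cth)) by (apply sin_gt_0; lra).
  replace (det_metric M x) with (- (x cr ^ 2 * sin (x cth)) ^ 2).
  2: { unfold det_metric, metric_diag. field. lra. }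
  rewrite Rabs_Ropp, Rabs_pos_eq by apply pow2_ge_0.
  apply sqrt_pow2. apply Rmult_le_pos; [apply pow2_ge_0|lra].
Qed.

Lemma hodge_stax_form (M : R) (x : point) (HM : 0 < M) (Hx : exterior M x)
  (w : Defs.form2) (tr tth rph thph : R) :
  (forall a b, w x a b = stax_form tr tth rph thph a b) ->
  forall a b, hodge M w x a b =
    stax_form (thph / (x cr ^ 2 * sin (x cth)))
           (- rph * fS M (x cr) / sin (x cth))
           (tth * sin (x cth) / fS M (x cr))
           (- tr * x cr ^ 2 * sin (x cth)) a b.
Proof.
  intros Hw c d.
  assert (Hf := exterior_fS_pos M x HM Hx). pose proof Hx as [Hr Hth].
  assert (Hs : 0 < sin (x cth)) by (apply sin_gt_0; lra).
  unfold hodge, sum4. rewrite !vol_up2_diag, !Hw. unfold vol.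
  rewrite !(sqrt_det_metric M x HM Hx).
  destruct (levi_civita_table c d) as (E1 & E2 & E3 & E4).
  rewrite (levi_civita_antisym_left cr cph), (levi_civita_antisym_left cth cph),
   (levi_civita_antisym_left ct cth), (levi_civita_antisym_left ct cr).
  rewrite E1, E2, E3, E4. unfold metric_diag.
  assert (E : forall a b, stax_form tr tth rph thph a b =
    match a, b with
    | ct, cr => tr | cr, ct => - tr | ct, cth => tth | cth, ct => - tth
    | cr, cph => rph | cph, cr => - rph | cth, cph => thph | cph, cth => - thph
    | _, _ => 0
    end) by (intros [] []; expand_comps; ring).
  rewrite !E.
  unfold stax_form. generalize (dxdx ct cth c d) (dxdx ct cr c d)
   (dxdx cr cph c d) (dxdx cth cph c d). intros.
  field. repeat split; lra.
Qed.

(** * The field and its invariants *)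

(* F_{r phi} = (1 - cos^2 theta) amp_r and F_{theta phi} = sin theta amp_th, with
   k = p B^3 M. *)
Definition amp_r1 (k th : R) : R := - 8 * k * (1 - cos th ^ 2).
Definition amp_r (k B lam r th : R) : R := B * r + lam * amp_r1 k th.
Definition amp_th1 (M k r th : R) : R :=
  - 8 * k * ((4 * r - 6 * M) * cos th - 2 * (2 * r - M) * cos th ^ 3).
Definition amp_th (M k B lam r th : R) : R :=
  B * r ^ 2 * cos th + lam * amp_th1 M k r th.

Lemma m_form_eq M x a :
  m_form M x a = x cr ^ 2 * sin (x cth) ^ 2 * kdelta cph a.
Proof. unfold m_form, sum4, d_phi, metric. destruct a; expand_comps; ring. Qed.

(** For w = g(r, theta) dphi one has dw = dg wedge dphi. Both m and v are of this kind. *)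
Lemma dext1_axial (g gr gth : R -> R -> R) (w : Defs.form1) (x : point) :
  (forall y a, w y a = g (y cr) (y cth) * kdelta cph a) ->
  is_derive (fun r => g r (x cth)) (x cr) (gr (x cr) (x cth)) ->
  is_derive (fun th => g (x cr) th) (x cth) (gth (x cr) (x cth)) ->
  forall a b, dext1 w x a b =
    stax_form 0 0 (gr (x cr) (x cth)) (gth (x cr) (x cth)) a b.
Proof.
  intros Hw Hr Hth.
  assert (P : forall a b, partial a (fun y => w y b) x =
    (kdelta a cr * gr (x cr) (x cth) + kdelta a cth * gth (x cr) (x cth))
    * kdelta cph b).
  { intros a b. unfold partial. rewrite (Derive_ext _ _ _ (fun s => Hw _ b)).
    rewrite Derive_scal_l. f_equal.
    apply is_derive_unique in Hr, Hth.
    destruct a; cbn -[Derive].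
    - rewrite Derive_const. ring.
    - etransitivity; [exact Hr|unfold kdelta; simpl; ring].
    - etransitivity; [exact Hth|unfold kdelta; simpl; ring].
    - rewrite Derive_const. ring. }
  intros a b. unfold dext1. rewrite !P. destruct a, b; expand_comps; ring.
Qed.

Lemma sin_sqr_cos (t : R) : sin t ^ 2 = 1 - cos t ^ 2.
Proof. rewrite <- !Rsqr_pow2. apply sin2. Qed.

Lemma F0_eq M B x a b :
  F0 M B x a b = stax_form 0 0 (B * x cr * (1 - cos (x cth) ^ 2))
    (sin (x cth) * (B * x cr ^ 2 * cos (x cth))) a b.
Proof.
  unfold F0, scal2.
  rewrite (dext1_axial (fun r th => r ^ 2 * sin th ^ 2)
    (fun r th => 2 * r * (1 - cos th ^ 2))
    (fun r th => 2 * r ^ 2 * sin th * cos th) _ x (m_form_eq M)).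
  - unfold stax_form. field.
  - auto_derive; [exact I|]. eq_in_R. rewrite <- (sin_sqr_cos (x cth)). ring.
  - auto_derive; [exact I|]. eq_in_R. ring.
Qed.

(** The double-angle formula, used twice, makes the coefficient a polynomial in cos theta, with 3 +
    cos 4 theta = 2 + 2 cos^2 2 theta. *)
Lemma v_form_eq M B p x a :
  v_form M B p x a =
  p * B ^ 3 * M / 2 * (4 * (2 * x cr - 5 * M) * (2 * cos (x cth) ^ 2 - 1)
    + (M - 2 * x cr) * (2 + 2 * (2 * cos (x cth) ^ 2 - 1) ^ 2)) * kdelta cph a.
Proof.
  unfold v_form.
  replace (4 * x cth) with (2 * (2 * x cth)) by ring.
  rewrite (cos_2a_cos (2 * x cth)), (cos_2a_cos (x cth)). field.
Qed.

Lemma dext1_v_form_eq M B p x a b :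
  dext1 (v_form M B p) x a b =
  stax_form 0 0 ((1 - cos (x cth) ^ 2) * amp_r1 (p * B ^ 3 * M) (x cth))
    (sin (x cth) * amp_th1 M (p * B ^ 3 * M) (x cr) (x cth)) a b.
Proof.
  refine (dext1_axial
    (fun r th => p * B ^ 3 * M / 2
      * (4 * (2 * r - 5 * M) * (2 * cos th ^ 2 - 1)
         + (M - 2 * r) * (2 + 2 * (2 * cos th ^ 2 - 1) ^ 2)))
    (fun r th => (1 - cos th ^ 2) * amp_r1 (p * B ^ 3 * M) th)
    (fun r th => sin th * amp_th1 M (p * B ^ 3 * M) r th)
    _ x (v_form_eq M B p) _ _ a b).
  - unfold amp_r1. auto_derive; [exact I|]. eq_in_R. field.
  - unfold amp_th1. auto_derive; [exact I|]. eq_in_R. field.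
Qed.

Lemma Fsol_eq M B p lam x a b :
  Fsol M B p lam x a b =
  stax_form 0 0 ((1 - cos (x cth) ^ 2) * amp_r (p * B ^ 3 * M) B lam (x cr) (x cth))
    (sin (x cth) * amp_th M (p * B ^ 3 * M) B lam (x cr) (x cth)) a b.
Proof.
  unfold Fsol, add2, scal2. rewrite F0_eq, dext1_v_form_eq.
  unfold stax_form, amp_r, amp_th. ring.
Qed.

(** The factors 1 / sin theta of the inverse metric have cancelled, so this expression continues
    smoothly to the poles, as the integration over [0, PI] requires. *)
Definition invF_sol (M k B lam r th : R) : R :=
  2 * (fS M r * amp_r k B lam r th ^ 2 * (1 - cos th ^ 2) / r ^ 2
       + (amp_th M k B lam r th / r ^ 2) ^ 2).

Lemma invF_Fsol M B p lam x :
  0 < M -> exterior M x ->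
  invF M (Fsol M B p lam) x = invF_sol M (p * B ^ 3 * M) B lam (x cr) (x cth).
Proof.
  intros HM Hx. assert (Hf := exterior_fS_pos M x HM Hx).
  destruct Hx as [Hr Hth].
  assert (Hs : 0 < sin (x cth)) by (apply sin_gt_0; lra).
  unfold invF, contract2, sum4. rewrite !raise2_diag, !Fsol_eq.
  unfold invF_sol. rewrite <- sin_sqr_cos.
  generalize (amp_r (p * B ^ 3 * M) B lam (x cr) (x cth))
    (amp_th M (p * B ^ 3 * M) B lam (x cr) (x cth)). intros u v.
  expand_comps. field. repeat split; lra.
Qed.

(** F occupies the slots (r, phi) and (theta, phi), its dual the slots (t, r) and (t, theta); they
    never meet in the contraction. *)
Lemma invG_Fsol M B p lam x :
  0 < M -> exterior M x -> invG M (Fsol M B p lam) x = 0.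
Proof.
  intros HM Hx. unfold invG, contract2, sum4.
  rewrite !raise2_diag, !(hodge_stax_form M x HM Hx _ _ _ _ _ (Fsol_eq M B p lam x)).
  rewrite !Fsol_eq. expand_comps. unfold Rdiv. ring.
Qed.

(** Applying the dual twice gives -1 on 2-forms here, so *Z = -4 L_F *F + 4 L_G F; [LF] and [LG]
    stand for the values of L_F and L_G. *)
Definition hodge_Z_sol (M k B : R) (LF LG lam r th : R) : coord -> coord -> R :=
  stax_form (- 4 * LF * (amp_th M k B lam r th / r ^ 2))
    (4 * LF * fS M r * amp_r k B lam r th * sin th)
    (4 * LG * ((1 - cos th ^ 2) * amp_r k B lam r th))
    (4 * LG * (sin th * amp_th M k B lam r th)).

Lemma hodge_Zform_Fsol M B p L lam x :
  0 < M -> exterior M x ->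
  forall a b, hodge M (Zform M L lam (Fsol M B p lam)) x a b =
  hodge_Z_sol M (p * B ^ 3 * M) B
    (part2 L lam (invF_sol M (p * B ^ 3 * M) B lam (x cr) (x cth)) 0)
    (part3 L lam (invF_sol M (p * B ^ 3 * M) B lam (x cr) (x cth)) 0)
    lam (x cr) (x cth) a b.
Proof.
  intros HM Hx a b.
  set (LF := part2 _ _ _ _). set (LG := part3 _ _ _ _).
  assert (Hf := exterior_fS_pos M x HM Hx).
  assert (Hs : 0 < sin (x cth)) by (apply sin_gt_0; apply Hx).
  assert (Hr : 0 < x cr) by (destruct Hx; lra).
  pose (rph := (1 - cos (x cth) ^ 2) * amp_r (p * B ^ 3 * M) B lam (x cr) (x cth)).
  pose (thph := sin (x cth) * amp_th M (p * B ^ 3 * M) B lam (x cr) (x cth)).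
  (* The four arguments are the components of Z = -4 (L_F F + L_G *F), which the second bullet
     verifies. *)
  rewrite (hodge_stax_form M x HM Hx _
    (- 4 * LG * (thph / (x cr ^ 2 * sin (x cth))))
    (- 4 * LG * (- rph * fS M (x cr) / sin (x cth)))
    (- 4 * LF * rph) (- 4 * LF * thph)).
  - unfold hodge_Z_sol, stax_form, rph, thph. rewrite <- sin_sqr_cos.
    field. repeat split; lra.
  - intros c d. unfold Zform.
    rewrite (invF_Fsol M B p lam x HM Hx), (invG_Fsol M B p lam x HM Hx).
    fold LF LG.
    rewrite (hodge_stax_form M x HM Hx _ _ _ _ _ (Fsol_eq M B p lam x)), Fsol_eq.
    fold rph thph. unfold stax_form. field. split; lra.
Qed.

(** * Derivatives and first-order balance *)

(** Agreement with [g] is asked only near x, since the closed form of *Z holds on the exterior. The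
    t- and phi-derivatives vanish because [g] sees only r and theta. *)
Lemma is_derive_upd (f : point -> R) (g : R -> R -> R) (x : point) (gr gth : R) :
  locally (x : coord -> R) (fun y => f y = g (y cr) (y cth)) ->
  is_derive (fun r => g r (x cth)) (x cr) gr ->
  is_derive (fun th => g (x cr) th) (x cth) gth ->
  forall a, is_derive (fun s => f (upd x a s)) (x a)
    (kdelta a cr * gr + kdelta a cth * gth).
Proof.
  intros [d Hd] Hr Hth a.
  apply (is_derive_ext_loc (fun s => g (upd x a s cr) (upd x a s cth))).
  { exists d. intros s Hs. symmetry. apply Hd. intro b. unfold upd.
    destruct (coord_eq_dec a b) as [<-|_]; [exact Hs|apply ball_center]. }
  destruct a; cbn; unfold kdelta; simpl.
  - replace (0 * gr + 0 * gth) with 0 by ring.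
    apply (is_derive_const (V := R_NormedModule)).
  - replace (1 * gr + 0 * gth) with gr by ring. exact Hr.
  - replace (0 * gr + 1 * gth) with gth by ring. exact Hth.
  - replace (0 * gr + 0 * gth) with 0 by ring.
    apply (is_derive_const (V := R_NormedModule)).
Qed.

(** The two differences are the (t, r, theta) and (r, theta, phi) components of dw; [s1] and [s2]
    are permutation signs or 0, which treats all 64 index triples at once. *)
Lemma dext2_stax_form (w : Defs.form2) (x : point)
  (tr_r tth_r rph_r thph_r tr_th tth_th rph_th thph_th : R) :
  (forall a b c, partial a (fun y => w y b c) x =
    kdelta a cr * stax_form tr_r tth_r rph_r thph_r b c
    + kdelta a cth * stax_form tr_th tth_th rph_th thph_th b c) ->
  forall a b c, exists s1 s2, Rabs s1 <= 1 /\ Rabs s2 <= 1 /\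
    dext2 w x a b c = s1 * (tr_th - tth_r) + s2 * (thph_r - rph_th).
Proof.
  intros H.
  assert (R0 : Rabs 0 <= 1) by (rewrite Rabs_R0; lra).
  assert (R1 : Rabs 1 <= 1) by (rewrite Rabs_R1; lra).
  assert (Rm1 : Rabs (-1) <= 1) by (rewrite Rabs_left; lra).
  intros a b c. unfold dext2. rewrite !H.
  destruct a, b, c; expand_comps;
  first [ exists 0, 0; split; [exact R0|]; split; [exact R0|]; ring
        | exists 1, 0; split; [exact R1|]; split; [exact R0|]; ring
        | exists (-1), 0; split; [exact Rm1|]; split; [exact R0|]; ring
        | exists 0, 1; split; [exact R0|]; split; [exact R1|]; ring
        | exists 0, (-1); split; [exact R0|]; split; [exact Rm1|]; ring ].
Qed.

(** From here on an added suffix [_r] or [_th] marks a derivative, whereas in [amp_r] and [amp_th]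
    it names the field component. *)
Definition amp_th1_r (k r th : R) : R := - 8 * k * (4 * cos th - 4 * cos th ^ 3).
Definition amp_th1_th (M k r th : R) : R :=
  - 8 * k * (6 * (2 * r - M) * cos th ^ 2 - (4 * r - 6 * M)) * sin th.
Definition amp_th_r (k B lam r th : R) : R :=
  2 * B * r * cos th + lam * amp_th1_r k r th.
Definition amp_th_th (M k B lam r th : R) : R :=
  - B * r ^ 2 * sin th + lam * amp_th1_th M k r th.
Definition amp_r1_th (k th : R) : R := - 16 * k * cos th * sin th.

Definition fS_r (M r : R) : R := 2 * M / r ^ 2.
(* invF_sol = 2 (weight amp_r^2 + (amp_th / r^2)^2) *)
Definition weight (M r th : R) : R := fS M r * (1 - cos th ^ 2) / r ^ 2.
Definition weight_r (M r th : R) : R := (1 - cos th ^ 2) * (6 * M / r ^ 4 - 2 / r ^ 3).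
Definition weight_th (M r th : R) : R := 2 * fS M r * cos th * sin th / r ^ 2.

(* amp_th / r^2 = namp0 + lam namp1 *)
Definition namp0 (B th : R) := B * cos th.
Definition namp1 (M k r th : R) := amp_th1 M k r th / r ^ 2.
Definition namp1_r (M k r th : R) := amp_th1_r k r th / r ^ 2 - 2 * amp_th1 M k r th / r ^ 3.
Definition namp1_th (M k r th : R) := amp_th1_th M k r th / r ^ 2.

(* Derivatives of the coefficients in invF_sol = inv0 + lam inv1 + lam^2 inv2 *)
Definition inv0_r M B r th :=
  2 * (weight_r M r th * (B * r) ^ 2 + 2 * weight M r th * B ^ 2 * r).
Definition inv0_th M B r th :=
  2 * (weight_th M r th * (B * r) ^ 2 - 2 * namp0 B th * (B * sin th)).
Definition inv1_r M k B r th :=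
  4 * (weight_r M r th * (B * r) * amp_r1 k th + weight M r th * B * amp_r1 k th
       + namp0 B th * namp1_r M k r th).
Definition inv1_th M k B r th :=
  4 * (weight_th M r th * (B * r) * amp_r1 k th + weight M r th * (B * r) * amp_r1_th k th
       - B * sin th * namp1 M k r th + namp0 B th * namp1_th M k r th).
Definition inv2_r M k r th :=
  2 * (weight_r M r th * amp_r1 k th ^ 2 + 2 * namp1 M k r th * namp1_r M k r th).
Definition inv2_th M k r th :=
  2 * (weight_th M r th * amp_r1 k th ^ 2 + 2 * weight M r th * amp_r1 k th * amp_r1_th k th
    + 2 * namp1 M k r th * namp1_th M k r th).
Definition inv_r M k B lam r th :=
  inv0_r M B r th + lam * (inv1_r M k B r th + lam * inv2_r M k r th).
Definition inv_th M k B lam r th :=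
  inv0_th M B r th + lam * (inv1_th M k B r th + lam * inv2_th M k r th).

Ltac nonzero_side_conditions :=
  repeat split; auto; try (eexists; eassumption);
  try apply Rmult_integral_contrapositive; auto with real.

Lemma is_derive_invF_sol_r M k B lam r th : r <> 0 ->
  is_derive (fun r => invF_sol M k B lam r th) r (inv_r M k B lam r th).
Proof.
  intros Hr. unfold invF_sol, amp_r, amp_r1, amp_th, amp_th1, fS.
  auto_derive; [nonzero_side_conditions|].
  eq_in_R.
  unfold inv_r, inv0_r, inv1_r, inv2_r, weight_r, weight, fS, namp0, namp1_r, namp1, amp_r1,
    amp_th1_r, amp_th1.
  field. auto.
Qed.

Lemma is_derive_invF_sol_th M k B lam r th : r <> 0 ->
  is_derive (fun th => invF_sol M k B lam r th) th (inv_th M k B lam r th).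
Proof.
  intros Hr. unfold invF_sol, amp_r, amp_r1, amp_th, amp_th1, fS.
  auto_derive; [nonzero_side_conditions|].
  eq_in_R.
  unfold inv_th, inv0_th, inv1_th, inv2_th, weight_th, weight, fS, namp0, namp1_th, namp1, amp_r1,
    amp_th1_th, amp_th1, amp_r1_th.
  field. auto.
Qed.

(* The r- and theta-derivatives of hodge_Z_sol when LF and LG have values u, w
   and derivatives u', w' *)
Definition hodge_Z_sol_r (M k B u u' w w' lam r th : R) : coord -> coord -> R :=
  stax_form
    (- 4 * u' * (amp_th M k B lam r th / r ^ 2) - 4 * u * (lam * namp1_r M k r th))
    (4 * (u' * fS M r * amp_r k B lam r th
          + u * (fS_r M r * amp_r k B lam r th + fS M r * B)) * sin th)
    (4 * ((1 - cos th ^ 2) * (w' * amp_r k B lam r th + w * B)))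
    (4 * sin th * (w' * amp_th M k B lam r th + w * amp_th_r k B lam r th)).
Definition hodge_Z_sol_th (M k B u u' w w' lam r th : R) : coord -> coord -> R :=
  stax_form
    (- 4 * u' * (amp_th M k B lam r th / r ^ 2)
     - 4 * u * (lam * namp1_th M k r th - B * sin th))
    (4 * fS M r * (u' * amp_r k B lam r th * sin th
       + u * (lam * amp_r1_th k th * sin th + amp_r k B lam r th * cos th)))
    (4 * (w' * ((1 - cos th ^ 2) * amp_r k B lam r th)
       + w * (2 * cos th * sin th * amp_r k B lam r th
              + (1 - cos th ^ 2) * (lam * amp_r1_th k th))))
    (4 * (w' * (sin th * amp_th M k B lam r th)
       + w * (cos th * amp_th M k B lam r th
              + sin th * amp_th_th M k B lam r th))).

Lemma is_derive_hodge_Z_sol_r M k B lam r th (u w : R -> R) (u' w' : R) :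
  r <> 0 -> is_derive u r u' -> is_derive w r w' -> forall a b,
  is_derive (fun r => hodge_Z_sol M k B (u r) (w r) lam r th a b) r
    (hodge_Z_sol_r M k B (u r) u' (w r) w' lam r th a b).
Proof.
  intros Hr Hu Hw a b. unfold hodge_Z_sol, hodge_Z_sol_r, stax_form.
  generalize (dxdx ct cth a b) (dxdx ct cr a b)
   (dxdx cr cph a b) (dxdx cth cph a b). intros d1 d2 d3 d4.
  unfold amp_r, amp_r1, amp_th, amp_th1, fS.
  auto_derive.
  - nonzero_side_conditions.
  - eq_in_R. assert (Eu : Derive (fun x : R => u x) r = u')
      by exact (is_derive_unique _ _ _ Hu).
    assert (Ew : Derive (fun x : R => w x) r = w')
      by exact (is_derive_unique _ _ _ Hw).
    rewrite Eu, Ew.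
    unfold namp1_r, amp_th1, fS_r, amp_th_r, amp_th1_r. field. auto.
Qed.

Lemma is_derive_hodge_Z_sol_th M k B lam r th (u w : R -> R) (u' w' : R) :
  r <> 0 -> is_derive u th u' -> is_derive w th w' -> forall a b,
  is_derive (fun th => hodge_Z_sol M k B (u th) (w th) lam r th a b) th
    (hodge_Z_sol_th M k B (u th) u' (w th) w' lam r th a b).
Proof.
  intros Hr Hu Hw a b. unfold hodge_Z_sol, hodge_Z_sol_th, stax_form.
  generalize (dxdx ct cth a b) (dxdx ct cr a b)
   (dxdx cr cph a b) (dxdx cth cph a b). intros d1 d2 d3 d4.
  unfold amp_r, amp_r1, amp_th, amp_th1, fS.
  auto_derive.
  - nonzero_side_conditions.
  - eq_in_R. assert (Eu : Derive (fun x : R => u x) th = u')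
      by exact (is_derive_unique _ _ _ Hu).
    assert (Ew : Derive (fun x : R => w x) th = w')
      by exact (is_derive_unique _ _ _ Hw).
    rewrite Eu, Ew.
    unfold namp1_th, amp_th_th, amp_th1_th, amp_r1_th, amp_th1. field. auto.
Qed.

(* On the solution the (t, r, theta) component of d*Z is
   lam^2 divZ_quad + R_F divZ_R2 + R_FF divZ_R22, with R the
   remainder of the Lagrangian. *)
Definition divZ_quad M k B p lam r th : R :=
  - 4 * (2 * p) *
   ((sin th * (fS_r M r * amp_r1 k th) + namp1_th M k r th) * invF_sol M k B lam r th
    + (inv1_r M k B r th + lam * inv2_r M k r th) * fS M r * amp_r k B lam r th * sin th
    + inv0_r M B r th * fS M r * amp_r1 k th * sin th
    + (inv1_th M k B r th + lam * inv2_th M k r th) * (amp_th M k B lam r th / r ^ 2)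
    + inv0_th M B r th * namp1 M k r th).
Definition divZ_R2 M k B lam r th : R :=
  - 4 * ((fS_r M r * amp_r k B lam r th + fS M r * B) * sin th
         + (lam * namp1_th M k r th - B * sin th)).
Definition divZ_R22 M k B lam r th : R :=
  - 4 * (inv_r M k B lam r th * fS M r * amp_r k B lam r th * sin th
         + inv_th M k B lam r th * (amp_th M k B lam r th / r ^ 2)).

(** The order-lambda part of d*Z = 0: the left side is the linear Maxwell operator applied to dv,
    the right side the source that the p F^2 term produces from F_0. This identity is what singles
    out the shape of v and the factor p B^3 M. *)
Lemma first_order_balance M B p r th : r <> 0 ->
  sin th * (fS_r M r * amp_r1 (p * B ^ 3 * M) th) + namp1_th M (p * B ^ 3 * M) r th
  = 8 * p * (inv0_r M B r th * fS M r * (B * r) * sin th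
             + inv0_th M B r th * namp0 B th).
Proof.
  intros Hr.
  unfold fS_r, amp_r1, namp1_th, amp_th1_th, inv0_r, inv0_th,
    weight_r, weight_th, weight, namp0, fS.
  field. auto.
Qed.

(** Here [u] is L_F on the solution, and [u_r], [u_th] are its derivatives by the chain rule; the
    left side is the (t, r, theta) component of d*Z. *)
Lemma flux_divergence M B p lam r th (R2 R22 : R) : r <> 0 ->
  let k := p * B ^ 3 * M in
  let u := - / 4 + 2 * lam * p * invF_sol M k B lam r th + R2 in
  let u_r := (2 * lam * p + R22) * inv_r M k B lam r th in
  let u_th := (2 * lam * p + R22) * inv_th M k B lam r th in
  (- 4 * u_th * (amp_th M k B lam r th / r ^ 2)
      - 4 * u * (lam * namp1_th M k r th - B * sin th))
  - (4 * (u_r * fS M r * amp_r k B lam r th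
          + u * (fS_r M r * amp_r k B lam r th + fS M r * B)) * sin th)
  = lam ^ 2 * divZ_quad M k B p lam r th + R2 * divZ_R2 M k B lam r th
    + R22 * divZ_R22 M k B lam r th.
Proof.
  intros Hr k u u_r u_th.
  (* Order zero: d*F_0 = 0. This combination multiplies all of [u], so it also removes the term of
     order lambda in which the correction to L_F meets F_0. *)
  assert (H0 : (fS_r M r * (B * r) + fS M r * B) * sin th - B * sin th = 0).
  { unfold fS_r, fS. field. auto. }
  assert (H1 := first_order_balance M B p r th Hr). fold k in H1.
  assert (Ha : amp_r k B lam r th = B * r + lam * amp_r1 k th) by reflexivity.
  assert (Hb : amp_th M k B lam r th / r ^ 2 = namp0 B th + lam * namp1 M k r th).
  { unfold amp_th, namp0, namp1. field. auto. }
  unfold divZ_quad, divZ_R2, divZ_R22, u, u_r, u_th, inv_r, inv_th. rewrite !Ha, !Hb.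
  set (X := invF_sol _ _ _ _ _ _).
  revert H0 H1.
  generalize (fS_r M r) (fS M r) (amp_r1 k th) (namp0 B th)
    (namp1 M k r th) (namp1_th M k r th)
    (sin th) (inv0_r M B r th) (inv0_th M B r th)
    (* With the coefficients abstracted, only [H0] and [H1] tie them together, and the claim is a
       polynomial identity modulo these two relations. *)
    (inv1_r M k B r th) (inv1_th M k B r th) (inv2_r M k r th) (inv2_th M k r th).
  intros fr f A1 B0 B1 B1t s I0r I0t I1r I1t I2r I2t H0 H1.
  (* [H0] is solved for a monomial so that [field] can rewrite with it; [H1] is solved for [B1t]. *)
  assert (H0' : fr * (B * r) * s = B * s - f * B * s) by lra.
  replace B1t with (8 * p * (I0r * f * (B * r) * s + I0t * B0) - s * (fr * A1)) by lra.
  field [H0'].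
Qed.

(** * Continuity and the order of d*Z *)

Lemma continuous_Rplus {T : UniformSpace} (f g : T -> R) x :
  continuous f x -> continuous g x ->
  continuous (fun z => f z + g z) x.
Proof. intros Hf Hg. exact (continuous_plus (V := R_NormedModule) f g x Hf Hg). Qed.
Lemma continuous_Ropp {T : UniformSpace} (f : T -> R) x :
  continuous f x -> continuous (fun z => - f z) x.
Proof. intros Hf. exact (continuous_opp (V := R_NormedModule) f x Hf). Qed.
Lemma continuous_Rmult {T : UniformSpace} (f g : T -> R) x :
  continuous f x -> continuous g x ->
  continuous (fun z => f z * g z) x.
Proof. intros Hf Hg. exact (continuous_mult (K := R_AbsRing) f g x Hf Hg). Qed.
Lemma continuous_Rpow {T : UniformSpace} (f : T -> R) n x :
  continuous f x -> continuous (fun z => f z ^ n) x.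
Proof.
  intros Hf. induction n as [|n IH]; simpl; [apply continuous_const|].
  apply continuous_Rmult; assumption.
Qed.
Lemma continuous_Rinv_fun {T : UniformSpace} (f : T -> R) x :
  continuous f x -> f x <> 0 ->
  continuous (fun z => / f z) x.
Proof.
  intros Hf H. apply (continuous_comp f Rinv); [exact Hf|].
  apply continuous_Rinv, H.
Qed.
Lemma continuous_cos_fun {T : UniformSpace} (f : T -> R) x :
  continuous f x -> continuous (fun z => cos (f z)) x.
Proof. intros Hf. apply (continuous_comp f cos); [exact Hf|apply continuous_cos]. Qed.
Lemma continuous_sin_fun {T : UniformSpace} (f : T -> R) x :
  continuous f x -> continuous (fun z => sin (f z)) x.
Proof. intros Hf. apply (continuous_comp f sin); [exact Hf|apply continuous_sin]. Qed.

Ltac cont_step :=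
  match goal with
  | |- continuous _ _ => assumption
  | |- continuous (fun _ => _ + _) _ => apply continuous_Rplus
  | |- continuous (fun _ => _ - _) _ => unfold Rminus; apply continuous_Rplus
  | |- continuous (fun _ => - _) _ => apply continuous_Ropp
  | |- continuous (fun _ => _ * _) _ => apply continuous_Rmult
  | |- continuous (fun _ => _ / _) _ => unfold Rdiv; apply continuous_Rmult
  | |- continuous (fun _ => _ ^ _) _ => apply continuous_Rpow
  | |- continuous (fun _ => / _) _ => apply continuous_Rinv_fun
  | |- continuous (fun _ => cos _) _ => apply continuous_cos_fun
  | |- continuous (fun _ => sin _) _ => apply continuous_sin_fun
  | |- continuous cos _ => apply continuous_cos
  | |- continuous sin _ => apply continuous_sin
  | |- continuous (fun x => x) _ => apply continuous_id
  | |- continuous (fun _ => ?c) _ => apply continuous_const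
  end.

Ltac unfold_sol := unfold divZ_quad, divZ_R2, divZ_R22,
  inv_r, inv_th, inv0_r, inv0_th, inv1_r, inv1_th, inv2_r, inv2_th,
  invF_sol, namp1_r, namp1_th, namp1, namp0, weight_r, weight_th, weight, fS_r, fS, amp_r1_th, amp_th_r,
  amp_th_th, amp_th1_r, amp_th1_th, amp_th, amp_th1, amp_r, amp_r1.

(* The (r, theta, phi) component of d*Z on the solution is
   R_G divZ_R3 + R_FG divZ_R23. *)
Definition divZ_R3 k B lam r th : R :=
  4 * sin th * amp_th_r k B lam r th
  - 4 * (2 * cos th * sin th * amp_r k B lam r th
         + (1 - cos th ^ 2) * (lam * amp_r1_th k th)).
Definition divZ_R23 M k B lam r th : R :=
  4 * sin th * amp_th M k B lam r th * inv_r M k B lam r th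
  - 4 * (1 - cos th ^ 2) * amp_r k B lam r th * inv_th M k B lam r th.

Ltac continuous_sol Hr0 :=
  unfold_sol; repeat cont_step; try (apply pow_nonzero); exact Hr0.

(** The arguments are arbitrary continuous maps, so the lemma applies to (lambda, x), to (lambda,
    theta) at fixed r, and to theta alone. *)
Lemma continuous_invF_sol {T : UniformSpace} M k B (l r th : T -> R) (z : T) :
  continuous l z -> continuous r z -> continuous th z -> r z <> 0 ->
  continuous (fun y => invF_sol M k B (l y) (r y) (th y)) z.
Proof. intros Hl Hr Ht Hr0. continuous_sol Hr0. Qed.
Lemma continuous_divZ_quad {T : UniformSpace} M k B p (l r th : T -> R) (z : T) :
  continuous l z -> continuous r z -> continuous th z -> r z <> 0 ->
  continuous (fun y => divZ_quad M k B p (l y) (r y) (th y)) z.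
Proof. intros Hl Hr Ht Hr0. continuous_sol Hr0. Qed.
Lemma continuous_divZ_R2 {T : UniformSpace} M k B (l r th : T -> R) (z : T) :
  continuous l z -> continuous r z -> continuous th z -> r z <> 0 ->
  continuous (fun y => divZ_R2 M k B (l y) (r y) (th y)) z.
Proof. intros Hl Hr Ht Hr0. continuous_sol Hr0. Qed.
Lemma continuous_divZ_R22 {T : UniformSpace} M k B (l r th : T -> R) (z : T) :
  continuous l z -> continuous r z -> continuous th z -> r z <> 0 ->
  continuous (fun y => divZ_R22 M k B (l y) (r y) (th y)) z.
Proof. intros Hl Hr Ht Hr0. continuous_sol Hr0. Qed.
Lemma continuous_divZ_R3 {T : UniformSpace} k B (l r th : T -> R) (z : T) :
  continuous l z -> continuous r z -> continuous th z ->
  continuous (fun y => divZ_R3 k B (l y) (r y) (th y)) z.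
Proof. intros Hl Hr Ht. unfold divZ_R3. unfold_sol. repeat cont_step. Qed.
Lemma continuous_divZ_R23 {T : UniformSpace} M k B (l r th : T -> R) (z : T) :
  continuous l z -> continuous r z -> continuous th z -> r z <> 0 ->
  continuous (fun y => divZ_R23 M k B (l y) (r y) (th y)) z.
Proof. intros Hl Hr Ht Hr0. unfold divZ_R23. continuous_sol Hr0. Qed.

Lemma locally_slots {T : UniformSpace} (P : R * (R * R) -> Prop)
  (phi : R * T -> R) (x0 : T) :
  continuous phi (0, x0) -> locally ((0, (phi (0, x0), 0)) : R * (R * R)) P ->
  locally ((0, x0) : R * T) (fun z => P (fst z, (phi z, 0))).
Proof.
  intros Hphi HP. destruct (proj1 (locally_triple_box _ _ _ _) HP) as [d Hd].
  assert (H : locally ((0, x0) : R * T) (fun z => Rabs (phi z - phi (0, x0)) < d)).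
  { apply (Hphi (fun u => Rabs (u - phi (0, x0)) < d)). exists d. intros u Hu. exact Hu. }
  assert (H' : locally ((0, x0) : R * T) (fun z => Rabs (fst z - 0) < d)).
  { exists d. intros z Hz. apply Hz. }
  generalize (filter_and _ _ H H'). apply filter_imp. intros z [H1 H2].
  apply Hd; auto using Rabs_diag.
Qed.

(** The invariant inserted for F itself varies with lambda and x; continuity of [phi] pulls the
    local bound at ([phi] (0, x0), 0) back to a neighbourhood of (0, x0). *)
Lemma flat_on_O_along {T : UniformSpace} (U : R * (R * R) -> Prop) g
  (phi : R * T -> R) (x0 : T) :
  open U -> (forall F G, U (0, (F, G))) -> flat_on U g ->
  continuous phi (0, x0) ->
  exists C, locally ((0, x0) : R * T)
    (fun z => Rabs (g (fst z) (phi z) 0) <= C * fst z ^ 2).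
Proof.
  intros HO H0 Hg Hphi.
  destruct (flat_on_O_lambda2 U g (phi (0, x0)) 0 HO H0 Hg) as [C HC].
  exists C. exact (locally_slots _ phi x0 Hphi HC).
Qed.

Lemma exterior_open M x : exterior M x -> locally (x : coord -> R) (exterior M).
Proof.
  intros [Hr Ht].
  assert (He : 0 < Rmin (x cr - 2 * M) (Rmin (x cth) (PI - x cth)))
    by (repeat apply Rmin_glb_lt; lra).
  exists (mkposreal _ He). intros y Hy.
  assert (H : forall a, Rabs (y a - x a)
    < Rmin (x cr - 2 * M) (Rmin (x cth) (PI - x cth)))
    by exact Hy.
  assert (M1 := Rmin_l (x cr - 2 * M) (Rmin (x cth) (PI - x cth))).
  assert (M2 := Rmin_r (x cr - 2 * M) (Rmin (x cth) (PI - x cth))).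
  assert (M3 := Rmin_l (x cth) (PI - x cth)).
  assert (M4 := Rmin_r (x cth) (PI - x cth)).
  assert (H1 := proj1 (Rabs_lt_between _ _) (H cr)).
  assert (H2 := proj1 (Rabs_lt_between _ _) (H cth)).
  unfold exterior. lra.
Qed.

Lemma locally_snd {T : UniformSpace} (P : T -> Prop) (l : R) (x : T) :
  locally x P -> locally ((l, x) : R * T) (fun z => P (snd z)).
Proof. intros [d Hd]. exists d. intros z Hz. apply Hd, Hz. Qed.

Lemma continuous_fst_at {T : UniformSpace} (x : R * T) : continuous (fun z => fst z) x.
Proof. apply continuous_fst. Qed.

Lemma continuous_coord (a : coord) (z : R * (coord -> R)) :
  continuous (fun y : R * (coord -> R) => snd y a) z.
Proof.
  intros P [d Hd]. exists d. intros y [_ Hy]. apply Hd, Hy.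
Qed.

(** [du] and [dw] are L_FF and L_FG at (I, 0). Since G vanishes identically on the solution, the
    chain rule runs through I alone. *)
Lemma is_derive_hodge_Zform M B p q L (U : R * (R * R) -> Prop) lam x :
  0 < M -> open U -> smooth_on U (remainder p q L) -> exterior M x ->
  U (lam, (invF_sol M (p * B ^ 3 * M) B lam (x cr) (x cth), 0)) ->
  let k := p * B ^ 3 * M in
  let r := x cr in let th := x cth in
  let I := invF_sol M k B lam r th in
  let u := part2 L lam I 0 in
  let w := part3 L lam I 0 in
  let du := 2 * lam * p + part2 (part2 (remainder p q L)) lam I 0 in
  let dw := part2 (part3 (remainder p q L)) lam I 0 in
  forall a b c,
  is_derive (fun s => hodge M (Zform M L lam (Fsol M B p lam)) (upd x a s) b c) (x a)
   (kdelta a cr * hodge_Z_sol_r M k B u (du * inv_r M k B lam r th)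
      w (dw * inv_r M k B lam r th) lam r th b c
    + kdelta a cth * hodge_Z_sol_th M k B u (du * inv_th M k B lam r th)
      w (dw * inv_th M k B lam r th) lam r th b c).
Proof.
  intros HM HO Hs Hx HU k r th I u w du dw a b c.
  assert (Hr : r <> 0) by (unfold r; destruct Hx; lra).
  assert (Hdu := is_derive_part2_slot2 p q L U _ _ _ HO Hs HU).
  assert (Hdw := is_derive_part3_slot2 p q L U _ _ HO Hs HU).
  assert (HIr := is_derive_invF_sol_r M k B lam r th Hr).
  assert (HIt := is_derive_invF_sol_th M k B lam r th Hr).
  apply (is_derive_upd (fun y => hodge M (Zform M L lam (Fsol M B p lam)) y b c)
    (fun r th => hodge_Z_sol M k B (part2 L lam (invF_sol M k B lam r th) 0)
       (part3 L lam (invF_sol M k B lam r th) 0) lam r th b c)).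
  - generalize (exterior_open M x Hx). apply filter_imp. intros y Hy.
    exact (hodge_Zform_Fsol M B p L lam y HM Hy b c).
  - apply (is_derive_hodge_Z_sol_r M k B lam r th
      (fun r => part2 L lam (invF_sol M k B lam r th) 0)
      (fun r => part3 L lam (invF_sol M k B lam r th) 0)); [exact Hr| |];
    rewrite (Rmult_comm _ (inv_r _ _ _ _ _ _)).
    + exact (is_derive_comp (fun s => part2 L lam s 0)
        (fun r => invF_sol M k B lam r th) r _ _ Hdu HIr).
    + exact (is_derive_comp (fun s => part3 L lam s 0)
        (fun r => invF_sol M k B lam r th) r _ _ Hdw HIr).
  - apply (is_derive_hodge_Z_sol_th M k B lam r th
      (fun th => part2 L lam (invF_sol M k B lam r th) 0)
      (fun th => part3 L lam (invF_sol M k B lam r th) 0)); [exact Hr| |];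
    rewrite (Rmult_comm _ (inv_th _ _ _ _ _ _)).
    + exact (is_derive_comp (fun s => part2 L lam s 0)
        (fun th => invF_sol M k B lam r th) th _ _ Hdu HIt).
    + exact (is_derive_comp (fun s => part3 L lam s 0)
        (fun th => invF_sol M k B lam r th) th _ _ Hdw HIt).
Qed.

Lemma Rabs_mult_le_r (s e : R) : Rabs s <= 1 -> Rabs (s * e) <= Rabs e.
Proof. intros H. rewrite Rabs_mult. assert (H' := Rabs_pos e). nra. Qed.

(** The summands bound the two independent components of d*Z; their sum serves every index
    triple. *)
Lemma dext2_hodge_Zform M B p q L (U : R * (R * R) -> Prop) lam x :
  0 < M -> open U -> smooth_on U (remainder p q L) -> exterior M x ->
  U (lam, (invF_sol M (p * B ^ 3 * M) B lam (x cr) (x cth), 0)) ->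
  let k := p * B ^ 3 * M in
  let r := x cr in let th := x cth in
  let I := invF_sol M k B lam r th in
  let Rm := remainder p q L in
  forall a b c,
  Rabs (dext2 (hodge M (Zform M L lam (Fsol M B p lam))) x a b c) <=
  Rabs (lam ^ 2 * divZ_quad M k B p lam r th + part2 Rm lam I 0 * divZ_R2 M k B lam r th
        + part2 (part2 Rm) lam I 0 * divZ_R22 M k B lam r th)
  + Rabs (part3 Rm lam I 0 * divZ_R3 k B lam r th
          + part2 (part3 Rm) lam I 0 * divZ_R23 M k B lam r th).
Proof.
  intros HM HO Hs Hx HU k r th I Rm a b c.
  assert (Hr : r <> 0) by (unfold r; destruct Hx; lra).
  destruct (smooth_on_ex_derive U _ _ _ _ Hs HU) as (_ & E2 & E3).
  destruct (dext2_stax_form _ x _ _ _ _ _ _ _ _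
    (fun a b c => is_derive_unique _ _ _
       (is_derive_hodge_Zform M B p q L U lam x HM HO Hs Hx HU a b c)) a b c)
    as (s1 & s2 & H1 & H2 & ->).
  rewrite (part2_of_remainder p q L _ _ _ E2), (part3_of_remainder p q L _ _ _ E3).
  rewrite (flux_divergence M B p lam (x cr) (x cth)
    (part2 (remainder p q L) lam
      (invF_sol M (p * B ^ 3 * M) B lam (x cr) (x cth)) 0)
    (part2 (part2 (remainder p q L)) lam
      (invF_sol M (p * B ^ 3 * M) B lam (x cr) (x cth)) 0) Hr).
  eapply Rle_trans; [apply Rabs_triang|]. apply Rplus_le_compat.
  - exact (Rabs_mult_le_r _ _ H1).
  - eapply Rle_trans; [exact (Rabs_mult_le_r _ _ H2)|]. apply Req_le. f_equal.
    unfold divZ_R3, divZ_R23, I, Rm, k, r, th. ring.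
Qed.

Lemma hodge_Zform_locally_U M B p (U : R * (R * R) -> Prop) x0 :
  0 < M -> open U -> (forall F G, U (0, (F, G))) -> exterior M x0 ->
  locally ((0, x0) : R * (coord -> R)) (fun z => exterior M (snd z) /\
    U (fst z, (invF_sol M (p * B ^ 3 * M) B (fst z) (snd z cr) (snd z cth), 0))).
Proof.
  intros HM HO H0 Hx.
  apply filter_and; [exact (locally_snd _ 0 x0 (exterior_open M x0 Hx))|].
  apply (locally_slots U (fun z : R * (coord -> R) =>
    invF_sol M (p * B ^ 3 * M) B (fst z) (snd z cr) (snd z cth)) x0).
  - apply continuous_invF_sol; try apply continuous_coord; [apply continuous_fst|].
    destruct Hx; simpl; lra.
  - apply HO, H0.
Qed.

Lemma Rabs_mult_le (a b A B : R) : Rabs a <= A -> Rabs b <= B -> Rabs (a * b) <= A * B.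
Proof.
  intros Ha Hb. rewrite Rabs_mult. apply Rmult_le_compat; auto using Rabs_pos.
Qed.

Lemma O_lambda2_dext2_hodge_Zform M B p q L a b c :
  0 < M -> lagrangian_expansion p q L ->
  O_lambda2 (exterior M) (fun lam x =>
     dext2 (hodge M (Zform M L lam (Fsol M B p lam))) x a b c).
Proof.
  intros HM [(U & HO & H0 & Hs) Hq] x0 Hx.
  assert (Hflat := remainder_flat_on p q L U Hs Hq).
  destruct (flat_on_part U _ HO H0 Hflat) as [F2 F3].
  destruct (flat_on_part U _ HO H0 F2) as [F22 _].
  destruct (flat_on_part U _ HO H0 F3) as [F32 _].
  set (k := p * B ^ 3 * M).
  assert (Hr0 : snd ((0, x0) : R * (coord -> R)) cr <> 0) by (destruct Hx; simpl; lra).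
  pose (phi := fun z : R * (coord -> R) =>
    invF_sol M k B (fst z) (snd z cr) (snd z cth)).
  assert (Cl := continuous_fst_at ((0, x0) : R * (coord -> R))).
  assert (Cr := continuous_coord cr (0, x0)).
  assert (Ct := continuous_coord cth (0, x0)).
  assert (Hphi : continuous phi (0, x0)) by (apply continuous_invF_sol; assumption).
  destruct (flat_on_O_along U _ phi x0 HO H0 F2 Hphi) as [C2 B2].
  destruct (flat_on_O_along U _ phi x0 HO H0 F3 Hphi) as [C3 B3].
  destruct (flat_on_O_along U _ phi x0 HO H0 F22 Hphi) as [C22 B22].
  destruct (flat_on_O_along U _ phi x0 HO H0 F32 Hphi) as [C32 B32].
  assert (L1 := continuous_locally_bounded _ _
    (continuous_divZ_quad M k B p _ _ _ _ Cl Cr Ct Hr0)).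
  assert (L2 := continuous_locally_bounded _ _
    (continuous_divZ_R2 M k B _ _ _ _ Cl Cr Ct Hr0)).
  assert (L3 := continuous_locally_bounded _ _
    (continuous_divZ_R22 M k B _ _ _ _ Cl Cr Ct Hr0)).
  assert (L4 := continuous_locally_bounded _ _
    (continuous_divZ_R3 k B _ _ _ _ Cl Cr Ct)).
  assert (L5 := continuous_locally_bounded _ _
    (continuous_divZ_R23 M k B _ _ _ _ Cl Cr Ct Hr0)).
  set (N1 := _ + 1) in L1. set (N2 := _ + 1) in L2. set (N3 := _ + 1) in L3.
  set (N4 := _ + 1) in L4. set (N5 := _ + 1) in L5.
  (* One term for each product: [N1] goes with the explicit lambda^2, and each other [N] bounds the
     coefficient of the remainder derivative bounded by its partner [C]. *)
  exists (N1 + C2 * N2 + C22 * N3 + (C3 * N4 + C32 * N5)).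
  generalize (filter_and _ _ (hodge_Zform_locally_U M B p U x0 HM HO H0 Hx)
    (filter_and _ _ (filter_and _ _ B2 (filter_and _ _ B3 (filter_and _ _ B22 B32)))
      (filter_and _ _ L1 (filter_and _ _ L2 (filter_and _ _ L3 (filter_and _ _ L4 L5)))))).
  apply filter_imp.
  clear Hx Hr0 B2 B3 B22 B32 L1 L2 L3 L4 L5.
  intros [lam x] ([Hx HU] & (B2 & B3 & B22 & B32) & (L1 & L2 & L3 & L4 & L5)).
  unfold phi in *. cbn [fst snd] in *.
  eapply Rle_trans; [apply (dext2_hodge_Zform M B p q L U lam x HM HO Hs Hx HU a b c)|].
  fold k.
  replace ((N1 + C2 * N2 + C22 * N3 + (C3 * N4 + C32 * N5)) * lam ^ 2) with
   ((lam ^ 2 * N1 + C2 * lam ^ 2 * N2 + C22 * lam ^ 2 * N3)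
    + (C3 * lam ^ 2 * N4 + C32 * lam ^ 2 * N5)) by ring.
  assert (Hl : Rabs (lam ^ 2) <= lam ^ 2) by (rewrite Rabs_pos_eq; [lra|apply pow2_ge_0]).
  apply Rplus_le_compat.
  - eapply Rle_trans; [apply Rabs_triang|]. apply Rplus_le_compat.
    + eapply Rle_trans; [apply Rabs_triang|].
      apply Rplus_le_compat; apply Rabs_mult_le; assumption.
    + apply Rabs_mult_le; assumption.
  - eapply Rle_trans; [apply Rabs_triang|].
    apply Rplus_le_compat; apply Rabs_mult_le; assumption.
Qed.

(** * Charges and asymptotics *)

Lemma continuous_slot2 (U : R * (R * R) -> Prop) g l (phi : R -> R) (x : R) :
  smooth_on U g -> U (l, (phi x, 0)) -> continuous phi x ->
  continuous (fun y => g l (phi y) 0) x.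
Proof.
  intros Hg HU Hphi.
  apply (continuous_comp phi (fun s => g l s 0) x Hphi).
  apply (ex_derive_continuous (V := R_NormedModule)).
  apply (smooth_on_ex_derive U g _ _ _ Hg HU).
Qed.

(** The phi-integral contributes 2 PI, so 4 PI c = 2 PI times the theta-integral, which is therefore
    2 c. *)
Lemma is_charge_axisymmetric (w : Defs.form2) (t r c : R) (h : R -> R) :
  (forall th ph, 0 < th < PI -> w (pt t r th ph) cth cph = h th) ->
  is_RInt h 0 PI (2 * c) -> is_charge w t r c.
Proof.
  intros Hw Hh. exists (fun _ => 2 * c). split.
  - intros ph _. apply (is_RInt_ext h); [|exact Hh].
    assert (HP := PI_RGT_0). rewrite Rmin_left, Rmax_right by lra.
    intros th Hth. symmetry. apply Hw, Hth.
  - replace (4 * PI * c) with (scal (2 * PI - 0) (2 * c)).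
    + apply (is_RInt_const (V := R_NormedModule)).
    + change (scal ?a ?b) with (a * b). eq_in_R. ring.
Qed.

(** For both charges the two coefficients already vanish on each sphere, so the limits are those of
    constants. *)
Lemma charge_at_infinity_zero M (w : R -> Defs.form2) t :
  (forall r, 2 * M < r -> charge_expansion w t r 0 0) ->
  charge_at_infinity M w t 0 0.
Proof.
  intros H. exists (fun _ => 0), (fun _ => 0).
  split; [exact H|]. split; apply is_lim_const.
Qed.

Lemma charge_expansion_Fsol M B p t r : charge_expansion (Fsol M B p) t r 0 0.
Proof.
  exists 0. apply filter_forall. intro lam. exists 0. split.
  2: { replace (0 - (0 + 0 * lam)) with 0 by ring. rewrite Rabs_R0. lra. }
  set (k := p * B ^ 3 * M).
  apply (is_charge_axisymmetric _ t r 0 (fun th => sin th * amp_th M k B lam r th)).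
  { intros th ph _. rewrite Fsol_eq. fold k. expand_comps. ring. }
  (* [V] is the phi-component of the potential B m / 2 + lambda v at fixed r; it depends on theta
     through cos^2 theta only. *)
  pose (V := fun th => B * r ^ 2 * (1 - cos th ^ 2) / 2 + lam * (k / 2
      * (4 * (2 * r - 5 * M) * (2 * cos th ^ 2 - 1)
         + (M - 2 * r) * (2 + 2 * (2 * cos th ^ 2 - 1) ^ 2)))).
  replace (2 * 0) with (minus (V PI) (V 0)).
  - apply (is_RInt_derive (V := R_CompleteNormedModule) V).
    + intros th _. unfold V, amp_th, amp_th1.
      auto_derive; [exact I|eq_in_R; field].
    + intros th _. unfold_sol. repeat cont_step.
  - change (minus (V PI) (V 0)) with (V PI - V 0). unfold V.
    rewrite cos_PI, cos_0. eq_in_R. field.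
Qed.

Lemma charge_expansion_hodge_Zform M B p q L t r :
  0 < M -> lagrangian_expansion p q L -> 2 * M < r ->
  charge_expansion (fun lam => hodge M (Zform M L lam (Fsol M B p lam))) t r 0 0.
Proof.
  intros HM [(U & HO & H0 & Hs) Hq] Hr.
  destruct (flat_on_part U _ HO H0 (remainder_flat_on p q L U Hs Hq)) as [_ F3].
  assert (HP := PI_RGT_0).
  assert (Hr0 : r <> 0) by lra.
  set (k := p * B ^ 3 * M).
  destruct (O_square_uniform_on_segment 0 PI
    (fun lam th => U (lam, (invF_sol M k B lam r th, 0)))
    (fun lam th => part3 (remainder p q L) lam (invF_sol M k B lam r th) 0
                   * (4 * (sin th * amp_th M k B lam r th)))) as [C HC].
  { intros th _.
    pose (phi := fun z : R * R => invF_sol M k B (fst z) r (snd z)).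
    assert (Cl := continuous_fst_at ((0, th) : R * R)).
    assert (Ct : continuous (fun z : R * R => snd z) (0, th)) by apply continuous_snd.
    assert (Hphi : continuous phi (0, th)).
    { apply continuous_invF_sol; auto using continuous_const. }
    destruct (flat_on_O_along U _ phi th HO H0 F3 Hphi) as [C HC].
    assert (HA : continuous (fun z : R * R =>
      4 * (sin (snd z) * amp_th M k B (fst z) r (snd z))) (0, th)).
    { unfold_sol. repeat cont_step. }
    apply continuous_locally_bounded in HA. set (N := _ + 1) in HA.
    exists (C * N).
    generalize (filter_and _ _ (locally_slots U phi th Hphi (HO _ (H0 _ 0)))
      (filter_and _ _ HC HA)).
    apply filter_imp. intros z (HU & B1 & B2). split; [exact HU|].
    replace (C * N * fst z ^ 2) with (C * fst z ^ 2 * N) by ring.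
    exact (Rabs_mult_le _ _ _ _ B1 B2). }
  (* The charge is half the integral over [0, PI] of a function bounded by C lambda^2. *)
  exists (PI * C). generalize HC. apply filter_imp. clear HC.
  intros lam HC.
  set (h := fun th => part3 (remainder p q L) lam (invF_sol M k B lam r th) 0
                   * (4 * (sin th * amp_th M k B lam r th))).
  assert (Hh : ex_RInt h 0 PI).
  { apply (ex_RInt_continuous (V := R_CompleteNormedModule)).
    rewrite Rmin_left, Rmax_right by lra. intros th Hth.
    apply continuous_Rmult.
    - apply (continuous_slot2 U _ lam (fun th => invF_sol M k B lam r th));
        [apply F3|exact (proj1 (HC th Hth))|].
      apply (continuous_invF_sol M k B (fun _ => lam) (fun _ => r) (fun th => th));
        auto using continuous_const, continuous_id.
    - unfold_sol. repeat cont_step. }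
  exists (RInt h 0 PI / 2). split.
  - apply (is_charge_axisymmetric _ t r _ h).
    + intros th ph Hth.
      assert (Hx : exterior M (pt t r th ph)) by (split; assumption).
      rewrite (hodge_Zform_Fsol M B p L lam _ HM Hx). cbn [pt]. fold k.
      assert (HU : U (lam, (invF_sol M k B lam r th, 0))) by (apply HC; lra).
      destruct (smooth_on_ex_derive U _ _ _ _ Hs HU) as (_ & _ & E3).
      rewrite (part3_of_remainder p q L _ _ _ E3).
      unfold h, hodge_Z_sol. expand_comps. ring.
    + assert (E : forall x : R, 2 * (x / 2) = x) by (intro; field). rewrite E.
      apply (RInt_correct (V := R_CompleteNormedModule)), Hh.
  - assert (HI : Rabs (RInt h 0 PI) <= (PI - 0) * (C * lam ^ 2)).
    { apply abs_RInt_le_const; [lra|exact Hh|]. intros th Hth. apply HC, Hth. }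
    assert (E : forall x : R, x / 2 - (0 + 0 * lam) = x * / 2) by (intro; field).
    rewrite E, Rabs_mult, (Rabs_pos_eq (/ 2)) by lra.
    assert (H1 := Rabs_pos (RInt h 0 PI)). lra.
Qed.

Lemma is_lim_inv_p_infty : is_lim Rinv p_infty 0.
Proof.
  apply (is_lim_inv (fun x => x) p_infty p_infty); [apply is_lim_id|discriminate].
Qed.

Lemma is_lim_dv_over_F0 M B p t th ph : B <> 0 -> 0 < th < PI ->
  (Rbar_locally p_infty (fun r => F0 M B (pt t r th ph) cr cph <> 0) ->
   is_lim (fun r => dext1 (v_form M B p) (pt t r th ph) cr cph
                    / F0 M B (pt t r th ph) cr cph) p_infty 0)
  /\ (Rbar_locally p_infty (fun r => F0 M B (pt t r th ph) cth cph <> 0) ->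
   is_lim (fun r => dext1 (v_form M B p) (pt t r th ph) cth cph
                    / F0 M B (pt t r th ph) cth cph) p_infty 0).
Proof.
  intros HB Hth. assert (Hs : 0 < sin th) by (apply sin_gt_0; lra).
  set (k := p * B ^ 3 * M).
  assert (Hpos : Rbar_locally p_infty (fun r => 0 < r)) by (exists 0; auto).
  split; intros Hne.
  - apply (is_lim_ext_loc (fun r => (- 8 * k * (1 - cos th ^ 2) / B) * / r)).
    + generalize Hpos. apply filter_imp. intros r Hr.
      rewrite F0_eq, dext1_v_form_eq. cbn [pt]. fold k. unfold amp_r1.
      rewrite <- sin_sqr_cos. expand_comps.
      field. repeat split; lra.
    + evar_last; [apply is_lim_scal_l, is_lim_inv_p_infty|]. simpl. f_equal. ring.
  (* At cos theta = 0 the denominator would vanish for every r, against [Hne]. *)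
  - assert (Hc : cos th <> 0).
    { intro E. destruct Hne as [N HN]. apply (HN (N + 1)); [lra|].
      rewrite F0_eq. cbn [pt]. rewrite E. expand_comps. ring. }
    apply (is_lim_ext_loc (fun r => (- 8 * k * (4 - 4 * cos th ^ 2) / B) * / r
      + (- 8 * k * (2 * M * cos th ^ 2 - 6 * M) / B) * (/ r * / r))).
    + generalize Hpos. apply filter_imp. intros r Hr.
      rewrite F0_eq, dext1_v_form_eq. cbn [pt]. fold k. unfold amp_th1. expand_comps.
      field. repeat split; lra.
    + replace 0 with (- 8 * k * (4 - 4 * cos th ^ 2) / B * 0
        + (- 8 * k * (2 * M * cos th ^ 2 - 6 * M) / B) * (0 * 0)) by ring.
      apply is_lim_plus'.
      * exact (is_lim_scal_l _ _ p_infty 0 is_lim_inv_p_infty).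
      * apply (is_lim_scal_l (fun r => / r * / r) _ p_infty (0 * 0)).
        exact (is_lim_mult _ _ p_infty 0 0 is_lim_inv_p_infty is_lim_inv_p_infty I).
Qed.

Lemma dext2_Fsol M B p lam x :
  ex_dext2 (Fsol M B p lam) x
  /\ forall a b c, dext2 (Fsol M B p lam) x a b c = 0.
Proof.
  set (k := p * B ^ 3 * M).
  (* The theta-derivative of F_{r phi} is entered directly as the r-derivative of F_{theta phi};
     proving this form is the content of dF = 0. *)
  assert (H : forall a b c, is_derive (fun s => Fsol M B p lam (upd x a s) b c) (x a)
    (kdelta a cr * stax_form 0 0 ((1 - cos (x cth) ^ 2) * B)
        (sin (x cth) * amp_th_r k B lam (x cr) (x cth)) b c
     + kdelta a cth * stax_form 0 0
        (sin (x cth) * amp_th_r k B lam (x cr) (x cth))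
        (cos (x cth) * amp_th M k B lam (x cr) (x cth)
         + sin (x cth) * amp_th_th M k B lam (x cr) (x cth)) b c)).
  { intros a b c.
    apply (is_derive_upd (fun y => Fsol M B p lam y b c)
      (fun r th => stax_form 0 0 ((1 - cos th ^ 2) * amp_r k B lam r th)
         (sin th * amp_th M k B lam r th) b c)).
    - apply filter_forall. intro y. apply Fsol_eq.
    - unfold stax_form.
      generalize (dxdx ct cth b c) (dxdx ct cr b c)
       (dxdx cr cph b c) (dxdx cth cph b c). intros.
      unfold_sol. auto_derive; [exact I|eq_in_R; ring].
    - unfold stax_form.
      generalize (dxdx ct cth b c) (dxdx ct cr b c)
       (dxdx cr cph b c) (dxdx cth cph b c). intros.
      unfold_sol. auto_derive; [exact I|eq_in_R; ring]. }
  split.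
  - intros a b c. eexists. apply H.
  - intros a b c.
    destruct (dext2_stax_form _ x _ _ _ _ _ _ _ _
      (fun a b c => is_derive_unique _ _ _ (H a b c)) a b c)
      as (s1 & s2 & _ & _ & ->). ring.
Qed.

Theorem mainTheorem2 :
  forall (M B p q : R) (L : R -> R -> R -> R),
  0 < M ->
  lagrangian_expansion p q L ->
  (* the coordinate expressions of m and F_0 *)
  (forall x a, exterior M x ->
     m_form M x a = x cr ^ 2 * sin (x cth) ^ 2 * kdelta cph a)
  /\ (forall x a b, exterior M x ->
     F0 M B x a b =
       B * (x cr * sin (x cth) ^ 2 * dxdx cr cph a b
            + x cr ^ 2 * cos (x cth) * sin (x cth) * dxdx cth cph a b))
  (* dF = 0 *)
  /\ (forall lam x, exterior M x ->
     ex_dext2 (Fsol M B p lam) x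
     /\ forall a b c, dext2 (Fsol M B p lam) x a b c = 0)
  (* d*Z = O(lambda^2) *)
  /\ (forall x0, exterior M x0 ->
     locally ((0, x0) : R * (coord -> R)) (fun z =>
       ex_dext2 (hodge M (Zform M L (fst z) (Fsol M B p (fst z)))) (snd z)))
  /\ (forall a b c,
     O_lambda2 (exterior M) (fun lam x =>
       dext2 (hodge M (Zform M L lam (Fsol M B p lam))) x a b c))
  (* (a) *)
  /\ (B <> 0 -> forall t th ph, 0 < th < PI ->
     (Rbar_locally p_infty (fun r => F0 M B (pt t r th ph) cr cph <> 0) ->
      is_lim (fun r => dext1 (v_form M B p) (pt t r th ph) cr cph
                       / F0 M B (pt t r th ph) cr cph) p_infty 0)
     /\ (Rbar_locally p_infty (fun r => F0 M B (pt t r th ph) cth cph <> 0) ->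
      is_lim (fun r => dext1 (v_form M B p) (pt t r th ph) cth cph
                       / F0 M B (pt t r th ph) cth cph) p_infty 0))
  (* (b) *)
  /\ (forall t,
     charge_at_infinity M
       (fun lam => hodge M (Zform M L lam (Fsol M B p lam))) t 0 0
     /\ charge_at_infinity M (fun lam => Fsol M B p lam) t 0 0).
Proof.
  intros M B p q L HM HL.
  split; [intros x a _; apply m_form_eq|].
  split.
  { intros x a b _. rewrite F0_eq, sin_sqr_cos. unfold stax_form. ring. }
  split; [intros lam x _; apply dext2_Fsol|].
  split.
  { intros x0 Hx. destruct HL as [(U & HO & H0 & Hs) _].
    generalize (hodge_Zform_locally_U M B p U x0 HM HO H0 Hx). apply filter_imp.
    intros [lam x] [Hx' HU] a b c. eexists.
    apply (is_derive_hodge_Zform M B p q L U lam x HM HO Hs Hx' HU). }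
  split; [intros a b c; exact (O_lambda2_dext2_hodge_Zform M B p q L a b c HM HL)|].
  split; [intros HB t th ph Hth; exact (is_lim_dv_over_F0 M B p t th ph HB Hth)|].
  intros t. split; apply charge_at_infinity_zero; intros r Hr.
  - exact (charge_expansion_hodge_Zform M B p q L t r HM HL Hr).
  - apply charge_expansion_Fsol.
Qed.
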